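(* Let $E$ be a real separable infinite-dimensional Hilbert space with inner product $\langle\cdot,\cdot\rangle$ and norm $|\cdot|_0$, and let $A$ be a positive Hilbert-Schmidt operator on $E$, with orthonormal basis $\{e_n\}_{n\ge 0}$ of $E$ consisting of eigenvectors, $Ae_n=\lambda_n e_n$, $\lambda_n>0$, $\sum_{n\ge0}\lambda_n^2<\infty$. For each integer $p\ge 0$ let $$\mathcal{E}_p=A^p(E)=\Big\{x\in E:\ \sum_{n\ge0}\lambda_n^{-2p}\langle x,e_n\rangle^2<\infty\Big\},\qquad |f|_p=|A^{-p}f|_0\quad(f\in\mathcal{E}_p),$$ and let $\mathcal{E}=\bigcap_{p\ge0}\mathcal{E}_p$ with the topology generated by the norms $|\cdot|_p$, $p\ge0$. Then $\mathcal{E}$ is a nuclear space, and there is a unique probability measure $\mu$ on the Borel $\sigma$-algebra of the dual $\mathcal{E}'$ such that there is a linear map $$E\to L^2(\mathcal{E}',\mu):\ \xi\mapsto\hat\xi$$ with $\hat e_j(f)=f(e_j)$ (for $\mu$-almost every $f\in\mathcal{E}'$) for every $j\ge0$, satisfying $$\int_{\mathcal{E}'}e^{it\hat\xi(x)}\,d\mu(x)=e^{-t^2|\xi|_0^2/2}$$ for every real $t$ and every $\xi\in E$.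
   Context: A nuclear space is a topological vector space $V$, complete, whose topology is generated by a countable family of inner product norms $|\cdot|_n$, such that, with $V_n$ the completion of $V$ in $|\cdot|_n$, for every $n$ there is $m\ge n$ for which the inclusion $V_m\to V_n$ is a Hilbert-Schmidt operator (i.e. there is an orthonormal basis $\{u_k\}$ of $V_m$ with $\sum_k|u_k|_n^2<\infty$). Here the scalars are real. $\mathcal{E}'$ is the space of continuous linear functionals on $\mathcal{E}$. The Borel $\sigma$-algebra of $\mathcal{E}'$ is the one generated by the weak topology on $\mathcal{E}'$, the coarsest vector topology making $f\mapsto f(v)$ continuous for every $v\in\mathcal{E}$ (it coincides with those generated by the strong and by the inductive limit topologies). *)

(* Defs.v *)
From HB Require Import structures.
From mathcomp Require Import all_boot all_order all_algebra complex.
From mathcomp Require Import all_classical all_reals all_analysis.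

Set Implicit Arguments.
Unset Strict Implicit.
Unset Printing Implicit Defensive.

Import Order.TTheory GRing.Theory Num.Theory.
Import numFieldNormedType.Exports.

Local Open Scope classical_set_scope.
Local Open Scope ring_scope.

HB.mixin Record isHilbert (R : realType) H & CompleteNormedModule R H := {
  inner : {dot H for idfun} ;
  normr_inner : forall x : H, `|x| = Num.sqrt (inner x x)
}.

#[short(type="hilbertType")]
HB.structure Definition Hilbert (R : realType) :=
  {H of isHilbert R H & CompleteNormedModule R H}.

Definition separable_space (T : topologicalType) : Prop :=
  exists2 D : set T, countable D & dense D.

Definition finite_dimensional (R : realType) (V : lmodType R) : Prop :=
  exists s : seq V, forall x, exists c : nat -> R,
    x = \sum_(i < size s) c i *: s`_i.

Definition finite_span (R : realType) (V : lmodType R) (I : Type)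
    (u : I -> V) : set V :=
  [set x | exists (s : seq I) (c : I -> R), x = \sum_(i <- s) c i *: u i].

Definition orthonormal_basis (R : realType) (H : hilbertType R)
    (I : choiceType) (u : I -> H) : Prop :=
  (forall i j, inner (u i) (u j) = (i == j)%:R) /\ dense (finite_span u).

(* The basis may be indexed by any type, so that finite-dimensional and
   non-separable domains are covered too. *)
Definition hilbert_schmidt (R : realType) (H K : hilbertType R)
    (T : {linear H -> K}) : Prop :=
  continuous T /\
  exists (I : choiceType) (u : I -> H), orthonormal_basis u /\
    (\esum_(i in [set: I]) (`|T (u i)| ^+ 2)%:E < +oo)%E.

(* Over the reals self-adjointness does not follow from non-negativity of the
   quadratic form, hence is required separately. *)
Definition positive_operator (R : realType) (H : hilbertType R)
    (T : {linear H -> H}) : Prop :=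
  (forall x y, inner (T x) y = inner x (T y)) /\
  (forall x, 0 <= inner (T x) x).

(* [norms_topology N] is a copy of [V] with the topology generated by the
   family [N], i.e. having as a subbase the open balls of all the [N n]. *)
Definition norms_topology (R : realType) (V : lmodType R)
  (N : nat -> V -> R) : Type := V.

Definition norm_balls (R : realType) (V : lmodType R) (N : nat -> V -> R)
    : set (set V) :=
  [set B | exists n x r, 0 < r /\ B = [set y | N n (y - x) < r]].

HB.instance Definition _ (R : realType) (V : lmodType R) (N : nat -> V -> R) :=
  Choice.on (norms_topology N).
HB.instance Definition _ (R : realType) (V : lmodType R) (N : nat -> V -> R) :=
  isSubBaseTopological.Build (norms_topology N) (norm_balls N) id.

(* Cauchy filters are taken for the translation-invariant uniformity. *)
Definition vector_complete (R : realType) (V : preTopologicalLmodType R)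
    : Prop :=
  forall F : set_system V, ProperFilter F ->
    (forall U, nbhs (0 : V) U ->
      exists2 A, F A & forall x y, A x -> A y -> U (x - y)) ->
    exists x : V, F --> x.

(* The completion is characterised up to isometric isomorphism;
   [j] is the canonical embedding of [V]. *)
Definition is_completion (R : realType) (V : lmodType R)
    (ip : {dot V for idfun}) (H : hilbertType R) (j : {linear V -> H})
    : Prop :=
  (forall x y, inner (j x) (j y) = ip x y) /\ dense (range j).

(* [T] below is the inclusion of V_m into V_n: the continuous extension to the
   completions of the identity of [V]. *)
Definition nuclear_space (R : realType) (V : preTopologicalLmodType R)
    : Prop :=
  [/\ continuous (fun x : V * V => x.1 + x.2),
      continuous (fun z : R^o * V => z.1 *: z.2),
      vector_complete V &
      exists ip : nat -> {dot V for idfun},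
        (@open V = @open (norms_topology (fun n x => Num.sqrt (ip n x x)))) /\
        exists (H : nat -> hilbertType R) (j : forall n, {linear V -> H n}),
          (forall n, is_completion (ip n) (j n)) /\
          forall n, exists2 m, (n <= m)%N &
            exists2 T : {linear H m -> H n},
              forall v, T (j m v) = j n v & hilbert_schmidt T].

Record dual (R : realType) (V : preTopologicalLmodType R) := Dual {
  dual_fun :> {linear V -> R^o} ;
  dual_continuous : continuous dual_fun }.

Section dual_instances.
Variables (R : realType) (V : preTopologicalLmodType R).

Lemma zero_functional_continuous : continuous (\0 : {linear V -> R^o}).
Proof. by move=> x; exact: cvg_cst. Qed.

HB.instance Definition _ := gen_eqMixin (dual V).
HB.instance Definition _ := gen_choiceMixin (dual V).
HB.instance Definition _ :=
  isPointed.Build (dual V) (Dual zero_functional_continuous).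

(* The coarsest topology making the evaluations continuous is a vector
   topology, hence it is the weak topology. *)
HB.instance Definition _ := Topological.copy (dual V)
  (sup_topology (fun v : V => Topological.class
    (initial_topology (fun f : dual V => f v)))).

End dual_instances.

Definition dual_borel (R : realType) (V : preTopologicalLmodType R) :=
  g_sigma_algebraType (@open (dual V)).
HB.instance Definition _ (R : realType) (V : preTopologicalLmodType R) :=
  Measurable.on (dual_borel V).

Section test_space.
Variables (R : realType) (E : hilbertType R) (A : {linear E -> E}).

Definition scale_space (p : nat) : set E := range (iter p A).

(* A^{-p} f; the default value 0 is used outside the range of A^p. *)
Definition inv_power (p : nat) (f : E) : E := xget 0 [set g | iter p A g = f].

Definition scale_norm (p : nat) (f : E) : R := `|inv_power p f|.

Definition test_pred : {pred E} := mem (\bigcap_p scale_space p).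

Lemma test_submod_closed : submod_closed test_pred.
Proof.
split=> [|a f g].
  rewrite inE => p _; exists 0 => //.
  by elim: p => //= p ->; rewrite linear0.
rewrite !inE => Ef Eg p _.
have [x _ <-] := Ef p I; have [y _ <-] := Eg p I.
exists (a *: x + y) => //.
by elim: p => //= p ->; rewrite linearP.
Qed.

HB.instance Definition _ :=
  GRing.isSubmodClosed.Build R E test_pred test_submod_closed.

Record test_space := TestSpace {
  test_val :> E ;
  test_valP : test_val \in test_pred }.

HB.instance Definition _ := [isSub for test_val].
HB.instance Definition _ := [Choice of test_space by <:].
HB.instance Definition _ := [SubChoice_isSubLmodule of test_space by <:].

HB.instance Definition _ := Topological.copy test_space
  (norms_topology (fun p (f : test_space) => scale_norm p f)).

End test_space.

Definition expi (R : realType) (x : R) : R[i] := (cos x +i* sin x)%C.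

Definition complex_integral d (T : measurableType d) (R : realType)
    (mu : {measure set T -> \bar R}) (f : T -> R[i]) : R[i] :=
  ((\int[mu]_x complex.Re (f x)) +i* (\int[mu]_x complex.Im (f x)))%C.

Section gaussian.
Variables (R : realType) (E : hilbertType R) (A : {linear E -> E}).
Variable e : nat -> E.

(* Elements of L^2 are classes modulo equality almost everywhere and carry no
   linear structure in the library, whence the linearity of [hat] is stated on
   representatives, to which [hat x] is coerced. *)
Definition white_noise (mu : probability (dual_borel (test_space A)) R)
    : Prop :=
  exists hat : E -> LspaceType mu (lee1n 2),
    [/\ forall (a : R) (x y : E),
          {ae mu, forall f, hat (a *: x + y) f = a * hat x f + hat y f},
        forall j, exists2 v : test_space A, test_val v = e j &
          {ae mu, forall f : dual (test_space A), hat (e j) f = f v} &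
        forall (t : R) (x : E),
          complex_integral mu (fun f => expi (t * hat x f)) =
          (expR (- (t ^+ 2 * `|x| ^+ 2 / 2)))%:C%C].

End gaussian.

(* Main.v *)
Require Import Defs.
From HB Require Import structures.
From mathcomp Require Import all_boot all_order all_algebra complex.
From mathcomp Require Import all_classical all_reals all_analysis.
From mathcomp Require Import measurable_realfun ring lra.

Set Implicit Arguments.
Unset Strict Implicit.
Unset Printing Implicit Defensive.

Import Order.TTheory GRing.Theory Num.Theory.
Import numFieldNormedType.Exports.

Local Open Scope classical_set_scope.
Local Open Scope ring_scope.

(** In the coordinates [<x, e_n>] the operator [A] is multiplication by [lambda_n],
so [A^p E] is a weighted sequence space and the inclusion of [E_(p+1)] into [E_p]
is a copy of [A]; this gives nuclearity.

For the measure, the binary digits of a uniform variable are split infinitely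
often to produce independent uniform variables, and the quantile function of the
normal law turns them into independent standard Gaussians [xi_n].  Since
[sum_n lambda_n^2 xi_n^2] is almost surely finite, [v |-> sum_n <v, e_n> xi_n]
is almost surely continuous for [|.|_1], and [mu] is the law of this random
functional.  For [x] in [E] the series [sum_n <x, e_n> f(e_n)] converges in
[L^2(mu)]; its sum is [hat x].

Conversely, every white noise measure integrates [cos (sum_k t_k f(e_k) + c)] in
the same way.  The functions on which two probabilities have the same integral
are closed under linear combinations and bounded limits; as products of cosines
are sums of cosines, this gives all cylinder sets.  These generate the Borel sets
of the dual: it is a countable union of polars of neighbourhoods of 0, each polar
is described by the coordinates [f(e_n)], and on a polar finitely many of them
determine a weak neighbourhood. *)

(** * Uniqueness of characteristic functions *)

(** Continuity for [|.|_1] comes from [<v, e_n> xi_n = <A^-1 v, e_n> (lambda_n xi_n)]: the second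
    factors are almost surely the coordinates of a vector of [E], so that the functional is an inner
    product with [A^-1 v].

    Laws are compared only through the real functions [cos (X + c)]. The free phase [c] carries the
    real and the imaginary part at once, and it allows one Gaussian variable to be integrated while
    the others are frozen inside [c]. Independence is read off in the same way: removing one binary
    digit exchanges the digits of even and odd rank, which gives a recursion for their joint
    characteristic function that the product law satisfies as well. Second moments too are drawn
    from characteristic functions, so that the construction of [hat] rests on the joint
    characteristic function of the coordinates.

    On the dual the obstacle is that the weak topology comes from uncountably many evaluations. On a
    polar the functionals are equicontinuous, so the evaluations at the [e_n] suffice there, and
    boxes with rational sides restore countability. *)

Section bounded_functions.
Context d (T : measurableType d) (R : realType).
Implicit Types f g : T -> R.

(** Such functions are integrable for every probability, so the class can be used for several
    measures at once. *)
Definition bmf f := measurable_fun setT f /\ exists M : R, forall x, `|f x| <= M.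

Lemma bmf_cst (c : R) : bmf (fun=> c).
Proof. by split=> //; exists `|c|. Qed.

Lemma bmfD f g : bmf f -> bmf g -> bmf (fun x => f x + g x).
Proof.
move=> [mf [M fM]] [mg [N gN]]; split; first exact: measurable_funD.
exists (M + N) => x; rewrite (le_trans (ler_normD _ _))//.
exact: lerD.
Qed.

Lemma bmfM f g : bmf f -> bmf g -> bmf (fun x => f x * g x).
Proof.
move=> [mf [M fM]] [mg [N gN]]; split; first exact: measurable_funM.
exists (M * N) => x; rewrite normrM.
exact: ler_pM.
Qed.

Lemma bmfZ (a : R) f : bmf f -> bmf (fun x => a * f x).
Proof. exact/bmfM/bmf_cst. Qed.

Lemma bmf_cos f : measurable_fun setT f -> bmf (fun x => cos (f x)).
Proof.
move=> mf; split.
  exact: (measurableT_comp (continuous_measurable_fun (@continuous_cos R)) mf).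
by exists 1 => x; rewrite ler_norml cos_geN1 cos_le1.
Qed.

Variable P : probability T R.

Lemma bmf_integrable f : bmf f -> P.-integrable setT (EFin \o f).
Proof.
move=> [mf [M fM]]; apply: measurable_bounded_integrable => //.
- by rewrite (le_lt_trans (probability_le1 _ _))// ltry.
- exists M; split; first by rewrite num_real.
  by move=> y My x _; rewrite /= (le_trans (fM x))// ltW.
Qed.

Lemma Rintegral_cst1 (c : R) : \int[P]_x c = c.
Proof.
rewrite (Rintegral_cst P measurableT c) /=.
have -> : P setT = 1%E := probability_setT P.
by rewrite mulr1.
Qed.

Lemma RintegralZD (a : R) f g : bmf f -> bmf g ->
  \int[P]_x (a * f x + g x) = a * \int[P]_x f x + \int[P]_x g x.
Proof.
move=> bf bg; rewrite RintegralD//; [|exact/bmf_integrable/bmfZ|exact: bmf_integrable].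
by rewrite RintegralZl//; exact: bmf_integrable.
Qed.

Lemma bounded_convergence_ae (u : nat -> T -> R) f (M : R) :
  (forall n, measurable_fun setT (u n)) -> measurable_fun setT f ->
  (forall n x, `|u n x| <= M) ->
  {ae P, forall x, u ^~ x @ \oo --> f x} ->
  (\int[P]_x u n x) @[n --> \oo] --> \int[P]_x f x.
Proof.
move=> mu_ mf uM uf.
have [|||||intf _ h] := @dominated_convergence _ _ _ P setT measurableT
    (fun n x => (u n x)%:E) (EFin \o f) (cst M%:E).
- by move=> n; exact/measurable_EFinP.
- exact/measurable_EFinP.
- by apply: filterS uf => x uf _; apply: cvg_EFin => //; exact: nearW.
- exact/(@bmf_integrable (cst M))/bmf_cst.
- by apply/nearW => x n _; rewrite lee_fin uM.
have fi : (\int[P]_x (f x)%:E)%E \is a fin_num.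
  by apply: integrable_fin_num.
apply: fine_cvg; rewrite /Rintegral fineK//.
Qed.

Lemma bounded_convergence (u : nat -> T -> R) f (M : R) :
  (forall n, measurable_fun setT (u n)) ->
  (forall n x, `|u n x| <= M) ->
  (forall x, u ^~ x @ \oo --> f x) ->
  (\int[P]_x u n x) @[n --> \oo] --> \int[P]_x f x.
Proof.
move=> mu_ uM uf; apply: bounded_convergence_ae uM _ => //.
  by apply: measurable_fun_cvg mu_ _ => x _; exact: uf.
exact/nearW.
Qed.

Lemma Rintegral_indic (A : set T) : measurable A ->
  \int[P]_x \1_A x = fine (P A).
Proof. by move=> mA; rewrite /Rintegral integral_indic// setIT. Qed.

End bounded_functions.

Section trigonometric_closure.
Context (T : Type) (R : realType) (L : set (T -> R)).

(* Probabilities that agree on the [cos (X + c)] agree on this class, which is an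
   algebra since products of cosines are combinations of cosines. *)
Inductive trig_closure : set (T -> R) :=
| trig_closure_cos X (c : R) : L X -> trig_closure (fun x => cos (X x + c))
| trig_closure_lin (a : R) f g : trig_closure f -> trig_closure g ->
    trig_closure (fun x => a * f x + g x)
| trig_closure_lim (u : nat -> T -> R) (f : T -> R) (M : R) :
    (forall n, trig_closure (u n)) -> (forall n x, `|u n x| <= M) ->
    (forall x, u ^~ x @ \oo --> f x) -> trig_closure f.

Hypothesis L_lin : forall (a : R) X Y, L X -> L Y -> L (fun x => a * X x + Y x).
Hypothesis L_nonempty : L !=set0.

Local Lemma L0 : L (fun=> 0).
Proof.
have [X LX] := L_nonempty.
have := L_lin (-1) LX LX.
by under eq_fun do rewrite mulN1r addNr.
Qed.

Lemma trig_closure_cst (c : R) : trig_closure (fun=> c).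
Proof.
have h0 : trig_closure (fun=> 0).
  rewrite [X in trig_closure X](_ : _ = fun x => cos ((fun=> 0) x + pi / 2)).
    exact/trig_closure_cos/L0.
  by apply/funext => x; rewrite add0r cos_pihalf.
have h1 : trig_closure (fun=> 1).
  rewrite [X in trig_closure X](_ : _ = fun x => cos ((fun=> 0) x + 0)).
    exact/trig_closure_cos/L0.
  by apply/funext => x; rewrite add0r cos0.
have := trig_closure_lin c h1 h0.
by under eq_fun do rewrite mulr1 addr0.
Qed.

Lemma trig_closureZ (a : R) f : trig_closure f -> trig_closure (fun x => a * f x).
Proof.
move=> tf; have := trig_closure_lin a tf (trig_closure_cst 0).
by under eq_fun do rewrite addr0.
Qed.

Lemma trig_closureD f g : trig_closure f -> trig_closure g ->
  trig_closure (fun x => f x + g x).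
Proof.
move=> tf tg; have := trig_closure_lin 1 tf tg.
by under eq_fun do rewrite mul1r.
Qed.

(** Serves products: [trig_closure_lim] asks for a bound uniform in [n], and multiplying a sequence
    by [g] multiplies that bound by one for [g]. *)
Local Lemma trig_closure_bounded f : trig_closure f -> exists M, forall x, `|f x| <= M.
Proof.
elim=> [X c _|a {}f g _ [M fM] _ [N gN]|u {}f M _ _ uM uf].
- by exists 1 => x; rewrite ler_norml cos_geN1 cos_le1.
- exists (`|a| * M + N) => x; rewrite (le_trans (ler_normD _ _))// lerD// normrM.
  exact: ler_wpM2l.
- exists M => x.
  have /cvg_lim <- // : (fun n => `|u n x|) @ \oo --> `|f x| by exact: cvg_norm.
  apply: limr_le; first by apply: is_cvg_norm; apply: cvgP (uf x).
  exact: nearW.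
Qed.

(** Induction on [f] and, when [f] is a cosine, on [g]; the base case is the product-to-sum formula
    for two cosines. *)
Lemma trig_closureM f g : trig_closure f -> trig_closure g ->
  trig_closure (fun x => f x * g x).
Proof.
move=> tf; elim: tf g => [X c LX|a {}f h _ IHf _ IHh|u {}f M tu IHu uM uf] g tg.
- elim: tg => [Y c' LY|a {}f h _ IHf _ IHh|u {}f M tu IHu uM uf].
  + rewrite [X in trig_closure X](_ : _ = fun x =>
      2^-1 * cos ((1 * X x + Y x) + (c + c')) +
      2^-1 * cos (((-1) * Y x + X x) + (c - c'))); last first.
      apply/funext => x.
      have -> : 1 * X x + Y x + (c + c') = (X x + c) + (Y x + c') by ring.
      have -> : (-1) * Y x + X x + (c - c') = (X x + c) - (Y x + c') by ring.
      by rewrite (cosD (X x + c)) (cosB (X x + c)); field.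
    by apply: trig_closureD; apply: trig_closureZ; apply: (trig_closure_cos _); exact: L_lin.
  + have := trig_closure_lin a IHf IHh.
    by under eq_fun do rewrite mulrCA -mulrDr.
  + apply: (@trig_closure_lim _ _ M IHu) => [n x|x].
      rewrite normrM (le_trans _ (uM n x))// ler_piMl// ler_norml.
      by rewrite cos_geN1 cos_le1.
    by apply: cvgM => //; exact: cvg_cst.
- have := trig_closure_lin a (IHf _ tg) (IHh _ tg).
  by under eq_fun do rewrite mulrA -mulrDl.
- have [N gN] := trig_closure_bounded tg.
  apply: (@trig_closure_lim _ _ (M * N) (fun n => IHu n _ tg)) => [n x|x].
    by rewrite normrM ler_pM.
  by apply: cvgM => //; exact: cvg_cst.
Qed.

Lemma trig_closureX f n : trig_closure f -> trig_closure (fun x => f x ^+ n).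
Proof.
move=> tf; elim: n => [|n IHn].
  by under eq_fun do rewrite expr0; exact: trig_closure_cst.
by under eq_fun do rewrite exprS; exact: trig_closureM.
Qed.

(* Iterating [q |-> q + (s^2 - q^2) / 2] from 0 increases to [|s|]. *)
Fixpoint abs_approx (n : nat) (s : R) : R :=
  if n is m.+1 then abs_approx m s + (s ^+ 2 - abs_approx m s ^+ 2) / 2 else 0.

(** With [r = |s|] and [q] the current approximation, one step multiplies the error by
    [1 - (r + q) / 2], which lies between 0 and [1 - r / 2] because [0 <= q <= r <= 1]. *)
Local Lemma abs_approxP n (s : R) : `|s| <= 1 ->
  0 <= abs_approx n s <= `|s| /\ `|s| - abs_approx n s <= (1 - `|s| / 2) ^+ n.
Proof.
move=> s1; have s0 := normr_ge0 s.
elim: n => [|n [/andP[q0 qs] qe]] /=.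
  by rewrite lexx s0 subr0 expr0.
rewrite -(real_normK (num_real s)).
move: (`|s|) (abs_approx n s) s0 s1 q0 qs qe => r q r0 r1 q0 qr qe.
have e : r - (q + (r ^+ 2 - q ^+ 2) / 2) = (r - q) * (1 - (r + q) / 2) by field.
split.
  rewrite -subr_ge0 [X in _ && X](_ : _ = (0 <= r - (q + (r ^+ 2 - q ^+ 2) / 2))).
    rewrite e; apply/andP; split; last by rewrite mulr_ge0//; lra.
    by rewrite subr0 addr_ge0// divr_ge0// subr_sqr mulr_ge0//; lra.
  by rewrite subr_ge0.
rewrite e exprSr; apply: ler_pM => //; lra.
Qed.

Lemma trig_closure_abs f : (forall x, `|f x| <= 1) -> trig_closure f ->
  trig_closure (fun x => `|f x|).
Proof.
move=> f1 tf.
apply: (@trig_closure_lim (fun n x => abs_approx n (f x)) _ 1) => [|n x|x].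
- elim=> [|n IHn] /=; first exact: trig_closure_cst.
  rewrite [X in trig_closure X](_ : _ = fun x => 2^-1 * f x ^+ 2 +
    (- 2^-1 * abs_approx n (f x) ^+ 2 + abs_approx n (f x))).
    apply: trig_closure_lin; first exact: trig_closureX.
    by apply: trig_closure_lin => //; exact: trig_closureX.
  by apply/funext => x; field.
- have [/andP[q0 qs] _] := abs_approxP n (f1 x).
  by rewrite ger0_norm// (le_trans qs).
(* Where [f] vanishes the geometric rate is 1 and gives nothing, but all approximations are 0
   there. *)
- have [->|fx0] := eqVneq (f x) 0.
    apply: cvg_near_cst; apply: nearW => n.
    have [/andP[q0 qs] _] := @abs_approxP n 0 ltac:(by rewrite normr0).
    by apply/le_anti; rewrite qs normr0 q0.
  apply/cvgrPdist_le => /= e e0.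
  have : (1 - `|f x| / 2) ^+ n @[n --> \oo] --> (0 : R).
    apply: cvg_expr; have := f1 x; have : 0 < `|f x| by rewrite normr_gt0.
    by move=> ? ?; rewrite ger0_norm; lra.
  move=> /cvgrPdist_le /(_ _ e0); apply: filterS => n.
  have [/andP[q0 qs] qe] := abs_approxP n (f1 x).
  rewrite sub0r normrN ger0_norm => [/(le_trans qe)|].
    by apply: le_trans; rewrite ger0_norm// subr_ge0.
  by apply: exprn_ge0; have := f1 x; lra.
Qed.

(** The function [g] is the positive part of [f]. As [0 <= g <= 1], the functions [1 - (1 - g)^n]
    are 0 where [g = 0] and tend to 1 elsewhere. *)
Lemma trig_closure_indic_gt0 f : (forall x, `|f x| <= 1) -> trig_closure f ->
  trig_closure (\1_[set x | 0 < f x]).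
Proof.
move=> f1 tf; pose g x := (`|f x| + f x) / 2.
have g01 x : 0 <= g x <= 1.
  rewrite /g; have := f1 x; have := ler_norm (f x); have := ler_norm (- f x).
  by rewrite normrN; lra.
have tg : trig_closure (fun x => 1 - g x).
  rewrite [X in trig_closure X](_ : _ = fun x => - 2^-1 * `|f x| + ((- 2^-1) * f x + 1)).
    apply: trig_closure_lin; first exact: trig_closure_abs.
    by apply: trig_closure_lin => //; exact: trig_closure_cst.
  by apply/funext => x; rewrite /g; field.
apply: (@trig_closure_lim (fun n x => (-1) * (1 - g x) ^+ n + 1) _ 1) => [n|n x|x].
- by apply: trig_closure_lin; [exact: trig_closureX|exact: trig_closure_cst].
- have /andP[g0 g1] := g01 x.
  have a : 0 <= (1 - g x) ^+ n <= 1 by rewrite exprn_ge0 ?exprn_ile1//; lra.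
  by rewrite ler_norml; lra.
- rewrite indicE; have /andP[g0 g1] := g01 x.
  have [fx0|fx0] := ltP 0 (f x).
    rewrite mem_set//= -[X in _ --> X]add0r; apply: cvgD; last exact: cvg_cst.
    rewrite -[X in _ --> X](mulr0 (-1)); apply: cvgM; first exact: cvg_cst.
    apply: cvg_expr; rewrite ger0_norm; last lra.
    by rewrite /g gtr0_norm//; lra.
  rewrite memNset/=; last by apply/negP; rewrite -leNgt.
  apply: cvg_near_cst; apply: nearW => n.
  by rewrite /g ler0_norm// addNr mul0r subr0 expr1n mulr1 addNr.
Qed.

(** [X] itself may be unbounded, so its sign relative to [a] is read from the sine of
    [(X - a) / n.+1]: the two signs agree as soon as this angle is smaller than [pi] in absolute
    value. The sine is a cosine with phase shifted by [pi / 2]. *)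
Lemma trig_closure_indic_gt X (a : R) : L X -> trig_closure (\1_[set x | a < X x]).
Proof.
move=> LX.
pose y n x := n.+1%:R^-1 * (X x - a).
apply: (@trig_closure_lim (fun n => \1_[set x | 0 < sin (y n x)]) _ 1) => [n|n x|x].
- apply: trig_closure_indic_gt0 => [x|].
    by rewrite ler_norml sin_geN1 sin_le1.
  rewrite [X in trig_closure X](_ : _ = fun x =>
      cos ((n.+1%:R^-1 * X x + 0) + (- (n.+1%:R^-1 * a) - pi / 2))).
    by apply: trig_closure_cos; apply: L_lin => //; exact: L0.
  apply/funext => x; rewrite -[LHS]cosBpihalf; congr cos; rewrite /y; ring.
- by rewrite indicE; case: (_ \in _); rewrite ?normr1 ?normr0.
- apply: cvg_near_cst.
  have : n.+1%:R^-1 * `|X x - a| @[n --> \oo] --> (0 : R).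
    rewrite -[X in _ --> X](mul0r `|X x - a|); apply: cvgM; last exact: cvg_cst.
    exact: cvg_harmonic.
  move=> /cvgrPdist_lt /(_ _ (pi_gt0 R)); apply: filterS => n.
  rewrite sub0r normrN ger0_norm; last by rewrite mulr_ge0.
  move=> ypi; rewrite !indicE; congr (_%:R); congr (nat_of_bool _).
  have n0 : 0 < n.+1%:R^-1 :> R by rewrite invr_gt0.
  apply/idP/idP; rewrite !inE/=; apply: contraTT.
    rewrite -!leNgt => Xa.
    have [Xa'|Xa'] := eqVneq (X x) a; first by rewrite /y Xa' subrr mulr0 sin0.
    rewrite -oppr_ge0 -sinN; apply/ltW/sin_gt0_pi.
    have {}Xa : 0 < a - X x by rewrite subr_gt0 lt_neqAle Xa' Xa.
    have -> : - y n x = n.+1%:R^-1 * (a - X x) by rewrite /y; ring.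
    rewrite mulr_gt0//=; move: ypi; rewrite distrC gtr0_norm//.
  rewrite -!leNgt => Xa; rewrite leNgt; apply/negP => aX; move: Xa.
  rewrite leNgt sin_gt0_pi// /y mulr_gt0 ?subr_gt0//=.
  by move: ypi; rewrite gtr0_norm ?subr_gt0.
Qed.

End trigonometric_closure.

Lemma measurable_fun_gt d (T : measurableType d) (R : realType) (f : T -> R) :
  (forall a, measurable [set x | a < f x]) -> measurable_fun setT f.
Proof.
move=> mf; apply: (measurability _ (RGenOInfty.measurableE R)) => //.
move=> _ [_ [a ->] <-]; rewrite setTI preimage_itvoy; exact: mf.
Qed.

Lemma trig_closure_bmf d (T : measurableType d) (R : realType) (L : set (T -> R)) f :
  (forall X, L X -> measurable_fun setT X) -> trig_closure L f -> bmf f.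
Proof.
move=> mL; elim=> [X c LX|a {}f g _ bf _ bg|u {}f M _ bu uM uf].
- by apply: bmf_cos; apply: measurable_funD => //; exact: mL.
- by apply: bmfD => //; exact: bmfZ.
- split.
    by apply: measurable_fun_cvg (fun n => (bu n).1) _ => x _; exact: uf.
  exists M => x.
  have /cvg_lim <- // : (fun n => `|u n x|) @ \oo --> `|f x| by exact: cvg_norm.
  apply: limr_le; first by apply: is_cvg_norm; apply: cvgP (uf x).
  exact: nearW.
Qed.

(** The sets whose indicator lies in the closure are stable under intersection, because the closure
    is stable under products. They contain the generators, and [P] and [Q] agree on them; the
    uniqueness theorem for measures concludes. As [L] is stable under linear combinations, this is
    the uniqueness of joint laws, not only of the law of each [X]. *)
Lemma characteristic_function_unique d (T : measurableType d) (R : realType)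
    (L : set (T -> R)) (P Q : probability T R) :
  L !=set0 ->
  (forall (a : R) X Y, L X -> L Y -> L (fun x => a * X x + Y x)) ->
  @measurable d T =
    <<s [set A | exists2 X, L X & exists a : R, A = [set x | a < X x]] >> ->
  (forall X (c : R), L X ->
    \int[P]_x cos (X x + c) = \int[Q]_x cos (X x + c)) ->
  forall A, measurable A -> P A = Q A.
Proof.
move=> L0 Llin mE PQ.
have mL X : L X -> measurable_fun setT X.
  move=> LX; apply: measurable_fun_gt => a.
  by rewrite mE; apply: sub_sigma_algebra; exists X => //; exists a.
have eqPQ f : trig_closure L f -> \int[P]_x f x = \int[Q]_x f x.
  elim=> [X c LX|a {}f g tf ef tg eg|u {}f M tu eu uM uf].
  - exact: PQ.
  - by rewrite !RintegralZD ?ef ?eg//; exact: (trig_closure_bmf mL).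
  - have mu_ n : measurable_fun setT (u n) by have [] := trig_closure_bmf mL (tu n).
    have hP := bounded_convergence (P := P) mu_ uM uf.
    have hQ := bounded_convergence (P := Q) mu_ uM uf.
    rewrite -(cvg_lim _ hP)// -(cvg_lim _ hQ)//; congr (lim _).
    by under eq_fun do rewrite eu.
pose G := [set A : set T | trig_closure L (\1_A)].
have GmE A : G A -> measurable A.
  move=> GA; have [mA _] := trig_closure_bmf mL GA.
  have := mA measurableT [set 1] (measurable_set1 _).
  rewrite setTI (_ : _ @^-1` _ = A)//; apply/seteqP; split=> x /=; rewrite indicE.
    by case: (boolP (x \in A)) => [|_ /eqP]; rewrite ?inE// eq_sym oner_eq0.
  by move=> Ax; rewrite mem_set.
move=> A mA.
apply: (@measure_unique _ _ _ G (fun=> setT)) => //.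
- rewrite mE; apply/seteqP; split.
    apply: smallest_sub; first exact: smallest_sigma_algebra.
    move=> _ [X LX [a ->]]; apply: sub_sigma_algebra.
    exact: trig_closure_indic_gt.
  rewrite -mE; apply: smallest_sub => //; exact: sigma_algebra_measurable.
- move=> B C GB GC; rewrite /G/= indicI; exact: trig_closureM.
- by move=> _; rewrite /G/= indicT; exact: trig_closure_cst.
- by rewrite bigcup_const.
- move=> B GB; have := eqPQ _ GB.
  rewrite !Rintegral_indic; [|exact: GmE..].
  move=> e; rewrite -[LHS]fineK ?fin_num_measure//; last exact: GmE.
  by rewrite e fineK// fin_num_measure//; exact: GmE.
- by move=> _; rewrite (le_lt_trans (probability_le1 _ _))// ltry.
Qed.

(** * Independent Gaussian variables on the unit interval *)

Section gaussian_characteristic_function.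
Context (R : realType).
Local Notation mu := (@lebesgue_measure R).
Implicit Types t x : R.
Variable c : R.

Definition gauss_pdf := @normal_pdf R 0 1.

Lemma gauss_pdfE x : gauss_pdf x = normal_peak 1 * expR (- (x ^+ 2 / 2)).
Proof. by rewrite /gauss_pdf normal_pdfE// /normal_fun subr0 expr1n mulNr. Qed.

Lemma integral_gauss (f : R -> R) : bmf f ->
  \int[normal_prob 0 1]_x f x = \int[mu]_x (f x * gauss_pdf x).
Proof.
move=> bf; rewrite /Rintegral; congr fine.
have dom := @normal_prob_dominates R 0 1.
rewrite -(Radon_Nikodym_change_of_variables dom)//=; last exact: bmf_integrable.
apply: ae_eq_integral => //.
- apply: emeasurable_funM; first by apply/measurable_EFinP; exact: bf.1.
  by apply: (measurable_int mu); apply: Radon_Nikodym_integrable.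
- apply/measurable_EFinP; apply: measurable_funM; first exact: bf.1.
  exact: measurable_normal_pdf.
- rewrite (_ : (fun x => (f x * _)%:E) =
    (fun x => ((f x)%:E * (gauss_pdf x)%:E)%E)); last exact/funext.
  apply: ae_eqe_mul2l => /=.
  rewrite Radon_NikodymE//=.
  case: cid => /= h [h1 h2 h3].
  (* Both densities have the same integral over every measurable set, hence agree almost
     everywhere. *)
  apply: integral_ae_eq => //=.
  + by apply/measurable_EFinP; exact: measurable_normal_pdf.
  + by move=> B _ mB; rewrite -h3.
Qed.

(** The primitive behind Stein's identity: its derivative is [t] times the integrand of [gauss_cf]
    minus that of its opposite derivative. *)
Definition sin_gauss t x := sin (t * x + c) * gauss_pdf x.

Lemma is_derive_gauss_pdf x : is_derive x 1 gauss_pdf (- x * gauss_pdf x).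
Proof.
have -> : gauss_pdf = fun x => normal_peak 1 * expR (- (x ^+ 2 / 2)).
  by apply/funext => y; exact: gauss_pdfE.
have h : is_derive x 1 (fun x : R => - (x ^+ 2 / 2)) (- x).
  by apply: is_derive_eq; rewrite !scaler1 /GRing.scale/=; field.
have := is_derive1_comp (is_derive_expR _) h.
move=> h2; apply: is_derive_eq.
by rewrite /GRing.scale/=; ring.
Qed.

Lemma is_derive_sin_gauss t x : is_derive x 1 (sin_gauss t)
  (t * (cos (t * x + c) * gauss_pdf x) - x * sin (t * x + c) * gauss_pdf x).
Proof.
have h : is_derive x 1 (fun x : R => t * x + c) t.
  by apply: is_derive_eq; rewrite /GRing.scale/=; ring.
have h2 := is_derive1_comp (is_derive_sin _) h.
have h3 := is_derive_gauss_pdf x.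
rewrite /sin_gauss; apply: is_derive_eq.
by rewrite /GRing.scale/=; ring.
Qed.

Lemma is_derive_cos_gauss t x :
  is_derive t 1 (fun t => cos (t * x + c) * gauss_pdf x) (- x * sin (t * x + c) * gauss_pdf x).
Proof.
have h : is_derive t 1 (fun t : R => t * x + c) x.
  by apply: is_derive_eq; rewrite /GRing.scale/=; ring.
have h2 := is_derive1_comp (is_derive_cos _) h.
apply: is_derive_eq.
by rewrite /GRing.scale/=; ring.
Qed.

Local Notation gauss_dom := (@normal_pdf R 0 (Num.sqrt 2)).
Local Notation C := (@normal_peak R 1 / @normal_peak R (Num.sqrt 2)).

Local Lemma sqrt2_neq0 : Num.sqrt 2 != 0 :> R.
Proof. by rewrite gt_eqF// sqrtr_gt0. Qed.

Local Lemma C_ge0 : 0 <= C.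
Proof. by rewrite divr_ge0// normal_peak_ge0. Qed.

(** From [(|x| / 2 - 1)^2 >= 0] one gets [|x| <= 1 + x^2 / 4 <= exp (x^2 / 4)], so the left side is
    at most a multiple of [exp (- x^2 / 4)], the profile of the normal density of variance 2. The
    constant [C] is the ratio of the two peaks. *)
Lemma gauss_pdf_moment_le x : `|x| * gauss_pdf x <= C * gauss_dom x.
Proof.
rewrite gauss_pdfE normal_pdfE ?sqrt2_neq0// (mulrA C) divfK; last first.
  by rewrite gt_eqF// normal_peak_gt0// sqrt2_neq0.
rewrite /normal_fun subr0 sqr_sqrtr// mulrCA ler_wpM2l ?normal_peak_ge0//.
have -> : - x ^+ 2 / (2 *+ 2) = - (x ^+ 2 / 2) + x ^+ 2 / 4 :> R by field.
rewrite expRD mulrC ler_wpM2l ?expR_ge0//.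
apply: le_trans (expR_ge1Dx _).
rewrite -(real_normK (num_real x)).
have := sqr_ge0 (`|x| / 2 - 1).
by rewrite !expr2; lra.
Qed.

Local Lemma integrable_dom : mu.-integrable setT (fun x => (C * gauss_dom x)%:E).
Proof.
under eq_fun do rewrite EFinM.
exact/integrableZl/integrable_normal_pdf.
Qed.

Let mgauss : measurable_fun setT gauss_pdf := measurable_normal_pdf 0 1.

Let mlin t : measurable_fun setT (fun x : R => t * x + c).
Proof. by apply: measurable_funD => //; exact: measurable_funM. Qed.

Let msin t : measurable_fun setT (fun x : R => sin (t * x + c)).
Proof. exact: (measurableT_comp (continuous_measurable_fun (@continuous_sin R)) (mlin t)). Qed.

Let mcos t : measurable_fun setT (fun x : R => cos (t * x + c)).
Proof. exact: (measurableT_comp (continuous_measurable_fun (@continuous_cos R)) (mlin t)). Qed.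

Local Lemma norm_sin_le1 x : `|sin x| <= 1.
Proof. by rewrite ler_norml sin_geN1 sin_le1. Qed.

Local Lemma norm_cos_le1 x : `|cos x| <= 1.
Proof. by rewrite ler_norml cos_geN1 cos_le1. Qed.

Local Lemma integrable_cos_gauss t :
  mu.-integrable setT (fun x => (cos (t * x + c) * gauss_pdf x)%:E).
Proof.
apply: (le_integrable measurableT _ _ (@integrable_normal_pdf R 0 1)).
  apply/measurable_EFinP; apply: measurable_funM; first exact: mcos.
  exact: mgauss.
move=> x _; rewrite lee_fin normrM ler_piMl//; exact: norm_cos_le1.
Qed.

Local Lemma integrable_xsin_gauss t :
  mu.-integrable setT (fun x => (x * sin (t * x + c) * gauss_pdf x)%:E).
Proof.
apply: (le_integrable measurableT _ _ integrable_dom).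
  apply/measurable_EFinP; apply: measurable_funM; last exact: mgauss.
  by apply: measurable_funM => //; exact: msin.
move=> x _; rewrite lee_fin normrM normrM.
rewrite [leRHS]ger0_norm; last by rewrite mulr_ge0 ?C_ge0// normal_pdf_ge0.
apply: le_trans (gauss_pdf_moment_le x).
rewrite (ger0_norm (normal_pdf_ge0 _ _ _)) ler_wpM2r ?normal_pdf_ge0//.
by rewrite ler_piMr// norm_sin_le1.
Qed.

Definition gauss_cf t := \int[mu]_x (cos (t * x + c) * gauss_pdf x).

Lemma is_derive_gauss_cf t :
  is_derive t 1 gauss_cf (- \int[mu]_x (x * sin (t * x + c) * gauss_pdf x)).
Proof.
(* The width 1 is arbitrary: the bound on the derivative is uniform in the frequency. *)
have I : `]t - 1, t + 1[%classic t by rewrite /= in_itv/=; apply/andP; split; lra.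
have der s x : derivable (fun t => cos (t * x + c) * gauss_pdf x) s 1.
  by have [] := is_derive_cos_gauss s x.
have dE s x : partial1of2 (fun t x => cos (t * x + c) * gauss_pdf x) s x =
    - x * sin (s * x + c) * gauss_pdf x.
  by rewrite partial1of2E; have [_ ->] := is_derive_cos_gauss s x.
have G0 x : 0 <= C * gauss_dom x by rewrite mulr_ge0 ?C_ge0// normal_pdf_ge0.
have Gub s x : `|partial1of2 (fun t x => cos (t * x + c) * gauss_pdf x) s x| <=
    C * gauss_dom x.
  rewrite dE 2!normrM normrN; apply: le_trans (gauss_pdf_moment_le x).
  rewrite (ger0_norm (normal_pdf_ge0 _ _ _)) ler_wpM2r ?normal_pdf_ge0//.
  by rewrite ler_piMr// norm_sin_le1.
have h1 := @derivable_under_integral _ _ _ mu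
  (fun t x => cos (t * x + c) * gauss_pdf x) _ measurableT _ _ _ I
  (fun s _ => integrable_cos_gauss s) (fun s x _ _ => der s x) _ G0 integrable_dom
  (fun s x _ _ => Gub s x).
have h2 := @differentiation_under_integral _ _ _ mu
  (fun t x => cos (t * x + c) * gauss_pdf x) _ measurableT _ _ _ I
  (fun s _ => integrable_cos_gauss s) (fun s x _ _ => der s x) _ G0 integrable_dom
  (fun s x _ _ => Gub s x).
apply: DeriveDef; first exact: h1.
rewrite -derive1E h2 -mulN1r -RintegralZl//; last exact: integrable_xsin_gauss.
by apply: eq_Rintegral => x _; rewrite dE; ring.
Qed.

Lemma cvg_gauss_pdf : gauss_pdf n%:R @[n --> \oo] --> (0 : R).
Proof.
have h : normal_peak 1 * (expR (- 2^-1) : R) ^+ n @[n --> \oo] --> (0 : R).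
  rewrite -[X in _ --> X](mulr0 (normal_peak 1)); apply: cvgM; first exact: cvg_cst.
  by apply: cvg_expr; rewrite ger0_norm ?expR_ge0// expR_lt1 oppr_lt0 invr_gt0.
apply: (squeeze_cvgr _ (cvg_cst 0) h); apply: nearW => n.
rewrite normal_pdf_ge0 gauss_pdfE/= ler_wpM2l ?normal_peak_ge0//.
rewrite -expRM_natl ler_expR mulrN lerN2 ler_wpM2r ?invr_ge0// -natrX ler_nat.
by case: n => // n; rewrite expnS expn1 leq_pmulr.
Qed.

Local Lemma cvg_integral_symitv (k : R -> R) : mu.-integrable setT (EFin \o k) ->
  (\int[mu]_(x in `[(- n.+1%:R)%R, n.+1%:R%R]) (k x)%:E)%E @[n --> \oo] -->
  (\int[mu]_x (k x)%:E)%E.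
Proof.
move=> ik.
under eq_fun do rewrite integral_mkcond.
have mk : measurable_fun setT k by apply/measurable_EFinP; exact: measurable_int ik.
have [|||||_ _ h] := @dominated_convergence _ _ _ mu setT measurableT
    (fun n => ((fun x => (k x)%:E) \_ `[(- n.+1%:R)%R, n.+1%:R%R])) (EFin \o k) (abse \o (EFin \o k)).
- move=> n; apply/(measurable_restrictT _ _).1 => //.
  by apply/measurable_EFinP; exact: measurable_funTS.
- exact/measurable_EFinP.
- apply/nearW => x _; apply: cvg_near_cst.
  exists (Num.trunc `|x|) => // n /= xn.
  rewrite patchE mem_set//= in_itv/= -ler_norml.
  by rewrite ltW// (lt_le_trans (truncnS_gt _))// ler_nat ltnS.
- exact: integrable_abse.
- apply/nearW => x n _ /=; rewrite patchE; case: ifP => //= _.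
  by rewrite normr0 lee_fin.
exact: h.
Qed.

Local Lemma clin t : continuous (fun x => t * x + c).
Proof. by move=> x; apply: cvgD; [exact: mulrl_continuous|exact: cvg_cst]. Qed.

(** Integration by parts: the difference of the integrands is the derivative of [sin_gauss t], which
    tends to 0 at both ends. Together with [is_derive_gauss_cf] this is the equation
    [phi' = - t phi]. *)
Lemma gauss_cf_stein t :
  \int[mu]_x (x * sin (t * x + c) * gauss_pdf x) = t * gauss_cf t.
Proof.
have ic := integrable_cos_gauss t; have isn := integrable_xsin_gauss t.
pose k x := t * (cos (t * x + c) * gauss_pdf x) - x * sin (t * x + c) * gauss_pdf x.
have itc : mu.-integrable setT (fun x => (t * (cos (t * x + c) * gauss_pdf x))%:E).
  by under eq_fun do rewrite EFinM; exact: integrableZl.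
have ik : mu.-integrable setT (EFin \o k).
  exact: (integrableB measurableT itc isn).
suff : \int[mu]_x k x = 0.
  rewrite RintegralB//.
  by rewrite RintegralZl// => /eqP; rewrite subr_eq0 => /eqP.
have ck : continuous k.
  move=> x; apply: cvgB.
    apply: cvgM; first exact: cvg_cst.
    apply: cvgM; last exact: continuous_normal_pdf.
    by apply: (continuous_comp (@clin t x)); exact: continuous_cos.
  apply: cvgM; last exact: continuous_normal_pdf.
  apply: cvgM => //.
  by apply: (continuous_comp (@clin t x)); exact: continuous_sin.
have dK x : derivable (sin_gauss t) x 1 by have [] := is_derive_sin_gauss t x.
have cK : continuous (sin_gauss t).
  by move=> x; apply/differentiable_continuous/derivable1_diffP.
(* The bound is [n.+1] because the interval must have positive length. *)
have FTC n : (\int[mu]_(x in `[(- n.+1%:R)%R, n.+1%:R%R]) (k x)%:E)%E =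
    (sin_gauss t n.+1%:R - sin_gauss t (- n.+1%:R))%:E.
  rewrite (@continuous_FTC2 _ k (sin_gauss t)).
  - by rewrite -EFinB.
  - by rewrite ltrNl (lt_trans _ (ltr0Sn _ _))// oppr_lt0.
  - exact: continuous_subspaceT.
  - split=> [x _| |]; first exact: dK.
      exact/cvg_at_right_filter/cK.
    exact/cvg_at_left_filter/cK.
  - by move=> x _; rewrite derive1E; have [_ ->] := is_derive_sin_gauss t x.
have h1 := cvg_integral_symitv ik.
rewrite (funext FTC) in h1.
have h2 : (sin_gauss t n.+1%:R - sin_gauss t (- n.+1%:R))%:E @[n --> \oo] --> (0%:E : \bar R).
  apply: cvg_EFin; first exact: nearW.
  have hK (u : nat -> R) : (forall n, gauss_pdf (u n) = gauss_pdf n.+1%:R) ->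
      sin_gauss t (u n) @[n --> \oo] --> (0 : R).
    move=> uE; apply/norm_cvg0P.
    have := cvg_gauss_pdf; rewrite -(cvg_shiftS (fun n => gauss_pdf n%:R)) => hg.
    apply: (squeeze_cvgr _ (cvg_cst 0) hg); apply: nearW => n.
    rewrite normr_ge0/= normrM -uE (ger0_norm (normal_pdf_ge0 _ _ _)).
    by rewrite ler_piMl ?normal_pdf_ge0// norm_sin_le1.
  rewrite -[X in _ --> X](subr0 0); apply: cvgB; apply: hK => // n.
  by rewrite !gauss_pdfE sqrrN.
by rewrite /Rintegral (cvg_unique _ h1 h2).
Qed.

Lemma gauss_cfE t : gauss_cf t = expR (- (t ^+ 2 / 2)) * cos c.
Proof.
(* The exponential is the integrating factor of [phi' = - t phi], so [psi] is constant. *)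
pose psi t := gauss_cf t * expR (t ^+ 2 / 2).
have dpsi (s : R) : is_derive s 1 psi 0.
  have h1 := is_derive_gauss_cf s; rewrite gauss_cf_stein in h1.
  have h : is_derive s 1 (fun x : R => x ^+ 2 / 2) s.
    by apply: is_derive_eq; rewrite !scaler1 /GRing.scale/=; field.
  have h2 := is_derive1_comp (is_derive_expR _) h.
  rewrite /psi; apply: is_derive_eq.
  by rewrite /GRing.scale/=; ring.
have : psi t = psi 0 by exact: is_derive_0_is_cst.
rewrite /psi expr0n mul0r expR0 mulr1.
have -> : gauss_cf 0 = cos c.
  rewrite /gauss_cf; under eq_Rintegral do rewrite mul0r add0r.
  rewrite RintegralZl//; last exact: integrable_normal_pdf.
  by rewrite /Rintegral integral_normal_pdf mulr1.
by move=> e; rewrite expRN mulrC -e mulfK// gt_eqF// expR_gt0.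
Qed.

Lemma normal_characteristic_function t :
  \int[normal_prob 0 1]_x cos (t * x + c) = expR (- (t ^+ 2 / 2)) * cos c.
Proof.
rewrite integral_gauss; last by exact: (bmf_cos (mlin t)).
exact: gauss_cfE.
Qed.

End gaussian_characteristic_function.

(** * Image laws and Fubini's theorem for bounded functions *)

Section bounded_functions_transfer.
Context d1 d2 (T1 : measurableType d1) (T2 : measurableType d2) (R : realType).

Lemma bmf_comp (f : T2 -> R) (X : T1 -> T2) :
  measurable_fun setT X -> bmf f -> bmf (f \o X).
Proof. by move=> mX [mf [M fM]]; split; [exact: measurableT_comp|exists M => x; exact: fM]. Qed.

Lemma law_ex (P : probability T1 R) (X : T1 -> T2) : measurable_fun setT X ->
  exists Q : probability T2 R, (forall A, Q A = P (X @^-1` A)) /\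
    forall f : T2 -> R, bmf f -> \int[Q]_y f y = \int[P]_x f (X x).
Proof.
move=> mX; pose Y := HB.pack_for {mfun T1 >-> T2} X (isMeasurableFun.Build _ _ _ _ X mX).
exists (distribution P Y); split=> // f bf; rewrite /Rintegral integral_distribution//.
  by apply/measurable_EFinP; exact: bf.1.
exact: (bmf_integrable P (bmf_comp mX bf)).
Qed.

Lemma eq_Rintegral_ae (P : probability T1 R) (f g : T1 -> R) : bmf f -> bmf g ->
  {ae P, forall x, f x = g x} -> \int[P]_x f x = \int[P]_x g x.
Proof.
move=> bf bg fg; congr fine; apply: ae_eq_integral => //.
- by apply/measurable_EFinP; exact: bf.1.
- by apply/measurable_EFinP; exact: bg.1.
- by apply: filterS fg => x -> .
Qed.

End bounded_functions_transfer.

Section bounded_functions_fubini.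
Context d1 d2 (T1 : measurableType d1) (T2 : measurableType d2) (R : realType).
Variables (P : probability T1 R) (Q : probability T2 R).
Variables (h : T1 * T2 -> R) (bh : bmf h).

Lemma bmf_section1 x : bmf (fun y => h (x, y)).
Proof. exact: (bmf_comp (pair1_measurable x) bh). Qed.

Lemma bmf_section2 y : bmf (fun x => h (x, y)).
Proof. exact: (bmf_comp (pair2_measurable y) bh). Qed.

Lemma Rintegral_prod1 : \int[(P \x Q)%E]_z h z = \int[P]_x \int[Q]_y h (x, y).
Proof.
rewrite /Rintegral -integral12_prod_meas1; last exact: (bmf_integrable (P \x Q)%E bh).
congr fine; apply: eq_integral => x _.
rewrite fineK//; apply: integrable_fin_num => //.
exact: (bmf_integrable Q (bmf_section1 x)).
Qed.

Lemma Rintegral_prod2 : \int[(P \x Q)%E]_z h z = \int[Q]_y \int[P]_x h (x, y).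
Proof.
rewrite /Rintegral -integral21_prod_meas1; last exact: (bmf_integrable (P \x Q)%E bh).
congr fine; apply: eq_integral => x _.
rewrite fineK//; apply: integrable_fin_num => //.
exact: (bmf_integrable P (bmf_section2 x)).
Qed.

End bounded_functions_fubini.

Lemma normr_Rintegral_le d (T : measurableType d) (R : realType)
    (P : probability T R) (f : T -> R) (M : R) :
  0 <= M -> bmf f -> {ae P, forall x, `|f x| <= M} -> `|\int[P]_x f x| <= M.
Proof.
move=> M0 bf fM.
have ig := bmf_integrable P bf.
apply: le_trans (le_normr_Rintegral _ ig) _ => //.
rewrite -(Rintegral_cst1 P M) /Rintegral fine_le//.
- by apply: integrable_fin_num => //; exact: integrable_norm ig.
- by apply: integrable_fin_num => //; exact: (bmf_integrable P (bmf_cst _ _)).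
- apply: ae_ge0_le_integral => //.
  + by apply/measurable_EFinP; apply: measurableT_comp => //; exact: bf.1.
  + by apply: filterS fM => x fM _; rewrite lee_fin.
Qed.

Lemma cos_lipschitz (R : realType) (x y : R) : `|cos x - cos y| <= `|x - y|.
Proof.
have cN (a b : R) : a <= b -> `|cos a - cos b| <= `|a - b|.
  move=> ab; have [|c _ e] := @MVT_segment R cos (fun x => - sin x) a b ab _.
    exact/continuous_subspaceT/continuous_cos.
  by rewrite distrC e normrM normrN distrC ler_piMl// sin_max.
by have [xy|/ltW yx] := leP x y; [exact: cN|rewrite distrC [leRHS]distrC; exact: cN].
Qed.

Lemma bmf_Rintegral d1 d2 (T1 : measurableType d1) (T2 : measurableType d2)
    (R : realType) (P : probability T1 R) (Q : probability T2 R) (h : T1 * T2 -> R) :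
  bmf h -> bmf (fun x => \int[Q]_y h (x, y)).
Proof.
move=> bh; split.
  apply: (measurableT_comp (fine_measurable measurableT)).
  exact: (measurable_fubini_F (bmf_integrable (P \x Q)%E bh)).
have [mh [M hM]] := bh.
exists `|M| => x; apply: normr_Rintegral_le => //; first exact: bmf_section1.
by apply: nearW => y; rewrite (le_trans (hM _))// ler_norm.
Qed.

Lemma eq_measure_Rintegral d (T : measurableType d) (R : realType)
    (P Q : probability T R) (f : T -> R) :
  (forall A, measurable A -> P A = Q A) -> \int[P]_x f x = \int[Q]_x f x.
Proof.
by move=> PQ; congr fine; apply: eq_measure_integral => A mA _; exact: PQ.
Qed.

Lemma Rintegral_bernoulli (R : realType) (p : R) (f : bool -> R) : 0 <= p <= 1 ->
  \int[bernoulli_prob p]_x f x = p * f true + (1 - p) * f false.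
Proof.
move=> p01.
have bf : bmf f.
  by split=> //; exists (Num.max `|f true| `|f false|) => -[]; rewrite le_max lexx ?orbT.
(* Adding [M] makes the integrand nonnegative; under a probability it can be subtracted
   afterwards. *)
pose M : R := `|f true| + `|f false|.
have -> : \int[bernoulli_prob p]_x f x = \int[bernoulli_prob p]_x (f x + M) - M.
  rewrite RintegralD//; [|exact: bmf_integrable|exact: (bmf_integrable _ (bmf_cst _ _))].
  by rewrite Rintegral_cst1 addrK.
rewrite /Rintegral integral_bernoulli_prob//; last first.
  have := ler_norm (- f true); have := ler_norm (- f false); rewrite !normrN => ? ?.
  have := normr_ge0 (f true); have := normr_ge0 (f false) => ? ?.
  by case; rewrite lee_fin /M; lra.
by rewrite /= /unstable.onem; ring.
Qed.

(** * The uniform law and its leading binary digit *)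

Section dyadic_shift.
Context (R : realType).
Local Notation mu := (@lebesgue_measure R).

Definition unif : probability (measurableTypeR R) R := uniform_prob (@ltr01 R).
Local Notation P := unif.

Lemma Rintegral_unif (f : R -> R) : bmf f -> \int[P]_x f x = \int[mu]_(x in `[0, 1]) f x.
Proof.
move=> bf; have [mf [M fM]] := bf.
have -> : \int[P]_x f x = \int[P]_x (f x + M) - M.
  rewrite RintegralD//; [|exact: bmf_integrable|exact: (bmf_integrable _ (bmf_cst _ _))].
  by rewrite Rintegral_cst1 addrK.
have l01 : mu `[0%R, 1%R]%classic = 1%E by rewrite lebesgue_measure_itv/= lte_fin ltr01 -EFinB subr0.
have fi (g : R -> R) : bmf g -> mu.-integrable `[0, 1] (EFin \o g).
  move=> [mg [N gN]]; apply: measurable_bounded_integrable => //.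
  - by rewrite [X in (X < _)%E](_ : _ = 1%E) ?ltry//; exact: l01.
  - exact: measurable_funTS.
  - exists N; split; first by rewrite num_real.
    by move=> y Ny x _; rewrite /= (le_trans (gN x))// ltW.
have -> : \int[P]_x (f x + M) = \int[mu]_(x in `[0, 1]) (f x + M).
  rewrite /Rintegral integral_uniform//.
  - by rewrite subr0 invr1 mul1e.
  - by apply/measurable_EFinP; apply: measurable_funD.
  - by move=> x; rewrite lee_fin -lerBlDr sub0r; have := fM x; rewrite ler_norml => /andP[].
rewrite RintegralD//; [|exact: fi|exact: (fi _ (bmf_cst _ _))].
rewrite (Rintegral_cst mu (measurable_itv _) M) (_ : fine _ = 1) ?mulr1 ?addrK//.
by rewrite -[RHS]/(fine 1%E); congr fine; exact: l01.
Qed.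

Lemma unif_ae : {ae P, forall x : R, 0 < x < 1}.
Proof.
pose N := ~` `]0%R, 1%R[%classic : set R.
have mN : measurable N by exact: measurableC.
exists N; split=> //.
have := Rintegral_indic P mN.
rewrite Rintegral_unif; last first.
  by split=> //; exists 1 => x; rewrite indicE; case: (_ \in _); rewrite ?normr1 ?normr0.
rewrite /Rintegral integral_indic//.
have -> : (N `&` `[0%R, 1%R]%classic) = [set 0] `|` [set 1].
  apply/seteqP; split=> x /=; rewrite !in_itv/=.
    move=> [/negP h /andP[x0 x1]]; move: h; rewrite negb_and -!leNgt.
    by move=> /orP[h|h]; [left|right]; apply/le_anti/andP; split.
  by move=> [->|->]; rewrite /N/= in_itv/= ?ltxx ?andbF ?lexx ?ler01.
rewrite measureU0//= ?lebesgue_measure_set1// => /eqP.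
by rewrite eq_sym fine_eq0 ?fin_num_measure// => /eqP.
Qed.

Lemma unif_cf (s c : R) : s * \int[P]_x cos (s * x + c) = sin (s + c) - sin c.
Proof.
rewrite Rintegral_unif; last by apply/bmf_cos; apply: measurable_funD => //; exact: measurable_funM.
have cl : continuous (fun x : R => s * x + c).
  by move=> x; apply: cvgD; [exact: mulrl_continuous|exact: cvg_cst].
have cc : continuous (fun x : R => cos (s * x + c)).
  by move=> x; apply: (continuous_comp (@cl x)); exact: continuous_cos.
have der (x : R) : is_derive x 1 (fun x : R => sin (s * x + c)) (s * cos (s * x + c)).
  have h : is_derive x 1 (fun x : R => s * x + c) s.
    by apply: is_derive_eq; rewrite /GRing.scale/=; ring.
  have h2 := is_derive1_comp (is_derive_sin _) h.
  by apply: is_derive_eq; rewrite mulrC.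
rewrite -RintegralZl//; last first.
  by apply: continuous_compact_integrable; [exact: segment_compact|exact: continuous_subspaceT].
rewrite /Rintegral (@continuous_FTC2 _ _ (fun x => sin (s * x + c)))//.
- by rewrite /= mulr1 mulr0 add0r.
- by apply: continuous_subspaceT => x; apply: cvgM; [exact: cvg_cst|exact: cc].
- split=> [x _| |].
  + by have [] := der x.
  + by apply/cvg_at_right_filter; apply: (continuous_comp (@cl _)); exact: continuous_sin.
  + by apply/cvg_at_left_filter; apply: (continuous_comp (@cl _)); exact: continuous_sin.
- by move=> x _; rewrite derive1E; have [_ ->] := der x.
Qed.

(** For [x] in the unit interval this puts the digit [a] in front of the binary expansion of [x]. *)
Definition halve (a : bool) (x : R) : R := (a%:R + x) / 2.

Lemma measurable_halve : measurable_fun setT (fun z : bool * R => halve z.1 z.2).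
Proof.
apply: measurable_funM => //; apply: measurable_funD => //.
have mb : measurable_fun setT (fun b : bool => b%:R : R) by [].
exact: (measurableT_comp mb measurable_fst).
Qed.

(** A fair digit put in front of a uniform variable gives a uniform variable. On characteristic
    functions, [sin (s + d) - sin d] is cut at [sin (s / 2 + d)], and the two pieces are the
    contributions of the digits 1 and 0. *)
Lemma Rintegral_unif_halve (f : R -> R) : bmf f ->
  \int[P]_x f x =
  2^-1 * (\int[P]_x f (halve true x) + \int[P]_x f (halve false x)).
Proof.
move=> bf.
have h01 : 0 <= (2^-1 : R) <= 1 by lra.
have [Q [QE Qint]] := @law_ex _ _ _ (measurableTypeR R) _ (bernoulli_prob (2^-1 : R) \x P)%E _ measurable_halve.
have Qf (g : R -> R) : bmf g -> \int[Q]_x g x =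
    2^-1 * (\int[P]_x g (halve true x) + \int[P]_x g (halve false x)).
  move=> bg; rewrite Qint// Rintegral_prod1; last exact: (bmf_comp measurable_halve bg).
  by rewrite Rintegral_bernoulli//=; field.
rewrite -Qf//; suff PQ : forall A, measurable A -> P A = Q A.
  exact: (@eq_measure_Rintegral _ (measurableTypeR R) R P Q f PQ).
apply: (@characteristic_function_unique _ (measurableTypeR R) R
   [set X : R -> R | exists s c : R, X = fun x => s * x + c] P Q).
- by exists (fun x => 0 * x + 0); exists 0, 0.
- move=> a _ _ [s [c ->]] [s' [c' ->]]; exists (a * s + s'), (a * c + c').
  by apply/funext => x; ring.
- apply/seteqP; split.
    rewrite [X in X `<=` _]RGenOInfty.measurableE; apply: smallest_sub.
      exact: smallest_sigma_algebra.
    move=> _ [a ->]; apply: sub_sigma_algebra.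
    exists (fun x => 1 * x + 0); first by exists 1, 0.
    exists a; apply/seteqP; split=> x /=; by rewrite in_itv/= andbT mul1r addr0.
  apply: smallest_sub; first exact: sigma_algebra_measurable.
  move=> _ [_ [s [c ->]] [a ->]].
  rewrite -preimage_itvoy -[X in measurable X]setTI.
  have : measurable_fun setT (fun x : R => s * x + c).
    by apply: measurable_funD => //; exact: measurable_funM.
  by apply.
- move=> _ c [s [c' ->]]; under eq_Rintegral do rewrite -addrA; rewrite Qf; last first.
    apply: bmf_cos; apply: measurable_funD => //.
    by apply: measurable_funD => //; exact: measurable_funM.
  pose d := c' + c; rewrite -/d.
  transitivity (2^-1 * (\int[P]_x cos (s / 2 * x + (s / 2 + d)) +
      \int[P]_x cos (s / 2 * x + d))); last first.
    by congr (_ * (_ + _)); apply: eq_Rintegral => x _; congr cos;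
      rewrite /halve/= /d; field.
  (* [unif_cf] determines the integral only for a nonzero frequency. *)
  have [->|s0] := eqVneq s 0.
    have e d' : \int[P]_x cos (0 * x + d') = cos d'.
      by under eq_Rintegral do rewrite mul0r add0r; rewrite Rintegral_cst1.
    by rewrite mul0r add0r !e; field.
  apply: (mulfI s0); rewrite unif_cf.
  rewrite mulrA mulrDr.
  rewrite !unif_cf (_ : s / 2 + (s / 2 + d) = s + d); last by field.
  ring.
Qed.

End dyadic_shift.

Lemma Rintegral_near d (T : measurableType d) (R : realType) (P : probability T R)
    (f : T -> R) (m M : R) : 0 <= M -> bmf f ->
  {ae P, forall x, `|f x - m| <= M} -> `|\int[P]_x f x - m| <= M.
Proof.
move=> M0 bf fM; rewrite -[X in _ - X](Rintegral_cst1 P) -RintegralB//; last 2 first.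
- exact: bmf_integrable.
- exact: (bmf_integrable _ (bmf_cst _ _)).
apply: normr_Rintegral_le => //.
by apply: bmfD => //; exact: bmf_cst.
Qed.

Lemma ae_imply d (T : measurableType d) (R : realType) (P : probability T R)
    (A B : T -> Prop) : (forall x, A x -> B x) ->
  {ae P, forall x, A x} -> {ae P, forall x, B x}.
Proof. by move=> AB; apply: filterS. Qed.

(** * Splitting a uniform variable into two independent ones *)

Section binary_digits.
Context (R : realType).
Local Notation P := (unif R).
Implicit Types x : R.

Definition digit x : bool := 2^-1 <= x.
Definition shift x : R := 2 * x - (digit x)%:R.

Fixpoint even_approx n x : R :=
  if n is m.+1 then halve (digit x) (even_approx m (shift (shift x))) else 0.

(* The numbers whose binary digits are the digits of [x] of even, resp. odd, rank. *)
Definition even_part x : R := limn (fun n => even_approx n x).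
Definition odd_part x : R := even_part (shift x).

Lemma even_approx_itv n x : 0 <= even_approx n x <= 1.
Proof.
elim: n x => [|n IHn] x /=; first by rewrite lexx ler01.
have := IHn (shift (shift x)); rewrite /halve.
by case: (digit x) => /=; lra.
Qed.

Lemma even_approx_nd n x : even_approx n x <= even_approx n.+1 x.
Proof.
elim: n x => [|n IHn] x; first by have /andP[] := even_approx_itv 1 x.
by rewrite /= ler_wpM2r ?invr_ge0// lerD2l; exact: IHn.
Qed.

Lemma is_cvg_even_approx x : cvgn (fun n => even_approx n x).
Proof.
apply: nondecreasing_is_cvgn.
  by apply/nondecreasing_seqP => n; exact: even_approx_nd.
by exists 1 => _ [n _ <-]; have /andP[] := even_approx_itv n x.
Qed.

Lemma cvg_even_approx x : even_approx n x @[n --> \oo] --> even_part x.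
Proof. exact: is_cvg_even_approx. Qed.

Lemma even_partE x : even_part x = halve (digit x) (even_part (shift (shift x))).
Proof.
have h1 : even_approx n.+1 x @[n --> \oo] --> even_part x.
  by have := @cvg_even_approx x; rewrite -(cvg_shiftS (fun n => even_approx n x)).
have h2 : even_approx n.+1 x @[n --> \oo] -->
    halve (digit x) (even_part (shift (shift x))).
  rewrite /= /halve; apply: cvgM; last exact: cvg_cst.
  by apply: cvgD; [exact: cvg_cst|exact: cvg_even_approx].
exact: (cvg_unique _ h1 h2).
Qed.

Lemma even_part_itv x : 0 <= even_part x <= 1.
Proof.
apply/andP; split.
  apply: limr_ge; first exact: is_cvg_even_approx.
  by apply: nearW => n; have /andP[] := even_approx_itv n x.
apply: limr_le; first exact: is_cvg_even_approx.
by apply: nearW => n; have /andP[] := even_approx_itv n x.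
Qed.

Lemma measurable_digit : measurable_fun setT (fun x => (digit x)%:R : R).
Proof.
rewrite (_ : (fun x => _) = \1_(`[2^-1, +oo[%classic)).
  exact: measurable_indic.
apply/funext => x; rewrite indicE /digit; congr (_%:R); congr nat_of_bool.
by apply/idP/idP; rewrite inE/= in_itv/= andbT.
Qed.

Lemma measurable_shift : measurable_fun setT shift.
Proof.
apply: measurable_funB; last exact: measurable_digit.
exact: measurable_funM.
Qed.

Lemma measurable_even_part : measurable_fun setT even_part.
Proof.
apply: (measurable_fun_cvg (h := fun n x => even_approx n x)); last first.
  by move=> x _; exact: cvg_even_approx.
elim=> [|n IHn] /=; first exact: measurable_cst.
apply: measurable_funM => //; apply: measurable_funD; first exact: measurable_digit.
apply: (measurableT_comp IHn); apply: measurableT_comp measurable_shift.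
exact: measurable_shift.
Qed.

Lemma measurable_odd_part : measurable_fun setT odd_part.
Proof. exact: measurableT_comp measurable_even_part measurable_shift. Qed.

(** The bound [x < 1] matters: [halve false 1] is [2^-1], whose digit is 1. Almost every [x]
    satisfies both bounds. *)
Lemma digit_halve (a : bool) x : 0 < x < 1 -> digit (halve a x) = a.
Proof.
move=> x01; rewrite /digit /halve; case: a => /=.
  by apply/idP; lra.
by apply/negbTE; rewrite -ltNge; lra.
Qed.

Lemma shift_halve (a : bool) x : 0 < x < 1 -> shift (halve a x) = x.
Proof. by move=> x01; rewrite /shift digit_halve// /halve; field. Qed.

(** A new leading digit moves every other digit by one rank, so the two parts change places. *)
Lemma even_part_halve (a : bool) x : 0 < x < 1 ->
  even_part (halve a x) = halve a (odd_part x).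
Proof. by move=> x01; rewrite even_partE digit_halve// shift_halve. Qed.

Lemma odd_part_halve (a : bool) x : 0 < x < 1 ->
  odd_part (halve a x) = even_part x.
Proof. by move=> x01; rewrite /odd_part shift_halve. Qed.

Let mlin2 d (T : measurableType d) (X Y : T -> R) (s t c : R) :
  measurable_fun setT X -> measurable_fun setT Y ->
  measurable_fun setT (fun z => s * X z + t * Y z + c).
Proof.
move=> mX mY; apply: measurable_funD => //; apply: measurable_funD.
  exact: measurable_funM.
exact: measurable_funM.
Qed.

Definition parts_cf (s t c : R) := \int[P]_x cos (s * even_part x + t * odd_part x + c).

Definition prod_cf (s t c : R) := \int[P]_x \int[P]_y cos (s * x + t * y + c).

(** After one digit is removed, [t] bears on the even part and [s / 2] on the odd part, while the
    digit itself adds [s / 2] or 0 to the phase. *)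
Lemma parts_cf_rec s t c : parts_cf s t c =
  2^-1 * (parts_cf t (s / 2) (s / 2 + c) + parts_cf t (s / 2) c).
Proof.
have mE := measurable_even_part; have mO := measurable_odd_part.
rewrite /parts_cf Rintegral_unif_halve; last exact/bmf_cos/mlin2.
have mh a : measurable_fun setT (halve a : R -> R).
  by apply: measurable_funM => //; exact: measurable_funD.
have bh a := bmf_comp (mh a) (bmf_cos (mlin2 s t c mE mO)).
have be d := bmf_cos (mlin2 t (s / 2) d mE mO).
congr (_ * (_ + _)); apply: eq_Rintegral_ae; [exact: bh|exact: be| |
  exact: bh|exact: be|]; apply: (ae_imply _ (@unif_ae R)) => x x01 /=;
  by rewrite even_part_halve// odd_part_halve//; congr cos; rewrite /halve/=; field.
Qed.

(** Only the first variable is split; Fubini's theorem then exchanges the variables to match the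
    order of frequencies in [parts_cf_rec]. *)
Lemma prod_cf_rec s t c : prod_cf s t c =
  2^-1 * (prod_cf t (s / 2) (s / 2 + c) + prod_cf t (s / 2) c).
Proof.
have ml u v w : measurable_fun setT (fun z : R * R => u * z.1 + v * z.2 + w).
  exact: mlin2.
have swap u v w : prod_cf u v w = prod_cf v u w.
  rewrite /prod_cf -(@Rintegral_prod1 _ _ _ _ _ P P (fun z => cos (u * z.1 + v * z.2 + w))).
    rewrite Rintegral_prod2; last exact: (bmf_cos (ml _ _ _)).
    by apply: eq_Rintegral => y _; apply: eq_Rintegral => x _ /=; congr cos; ring.
  exact: (bmf_cos (ml _ _ _)).
rewrite {1}/prod_cf Rintegral_unif_halve; last first.
  exact: (bmf_Rintegral P P (bmf_cos (ml s t c))).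
rewrite (swap t (s / 2) (s / 2 + c)) (swap t (s / 2) c).
have e a : \int[P]_x \int[P]_y cos (s * halve a x + t * y + c) =
    prod_cf (s / 2) t (a%:R * (s / 2) + c).
  apply: eq_Rintegral => x _; apply: eq_Rintegral => y _; congr cos.
  by rewrite /halve; field.
by rewrite (e true) (e false) mul1r mul0r add0r.
Qed.

Lemma parts_cf_near s t c : `|parts_cf s t c - cos c| <= `|s| + `|t|.
Proof.
apply: Rintegral_near => //.
  by apply: bmf_cos; apply: mlin2; [exact: measurable_even_part|exact: measurable_odd_part].
apply: nearW => x; rewrite (le_trans (cos_lipschitz _ _))// addrK.
have /andP[E0 E1] := even_part_itv x; have /andP[a0 a1] := even_part_itv (shift x).
rewrite (le_trans (ler_normD _ _))// !normrM lerD// ler_piMr//.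
  by rewrite ger0_norm.
by rewrite ger0_norm.
Qed.

Lemma prod_cf_near s t c : `|prod_cf s t c - cos c| <= `|s| + `|t|.
Proof.
have ml : measurable_fun setT (fun z : R * R => s * z.1 + t * z.2 + c).
  exact: mlin2.
apply: Rintegral_near => //; first exact: (bmf_Rintegral P P (bmf_cos ml)).
apply: (ae_imply _ (@unif_ae R)) => x /andP[x0 x1].
apply: Rintegral_near => //; first exact: (bmf_section1 (bmf_cos ml) x).
apply: (ae_imply _ (@unif_ae R)) => y /andP[y0 y1].
rewrite (le_trans (cos_lipschitz _ _))// addrK.
rewrite (le_trans (ler_normD _ _))// !normrM lerD// ler_piMr//.
  by rewrite gtr0_norm// ltW.
by rewrite gtr0_norm// ltW.
Qed.

(* Both sides satisfy the same recursion, which halves the frequencies. *)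
Lemma parts_cfE s t c : parts_cf s t c = prod_cf s t c.
Proof.
have h n : forall s t c, `|parts_cf s t c - prod_cf s t c| <= 2 * (`|s| + `|t|) / 2 ^+ n.
  have step (D1 D2 : R -> R -> R -> R) (M : R -> R -> R) :
      (forall s t c, D1 s t c = 2^-1 * (D1 t (s / 2) (s / 2 + c) + D1 t (s / 2) c)) ->
      (forall s t c, D2 s t c = 2^-1 * (D2 t (s / 2) (s / 2 + c) + D2 t (s / 2) c)) ->
      (forall s t c, `|D1 s t c - D2 s t c| <= M s t) ->
      forall s t c, `|D1 s t c - D2 s t c| <= M t (s / 2).
    move=> e1 e2 DM {}s {}t {}c; rewrite e1 e2 -mulrBr.
    rewrite normrM ger0_norm ?invr_ge0// ler_pdivrMl//.
    rewrite (_ : _ + _ - _ = (D1 t (s / 2) (s / 2 + c) - D2 t (s / 2) (s / 2 + c)) +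
       (D1 t (s / 2) c - D2 t (s / 2) c)); last by ring.
    by rewrite (le_trans (ler_normD _ _))// mulr_natl mulr2n lerD.
  elim: n => [|n IHn] {}s {}t {}c.
    rewrite expr0 divr1 mulr_natl mulr2n.
    have := parts_cf_near s t c; have := prod_cf_near s t c => h1 h2.
    rewrite (_ : _ - _ = (parts_cf s t c - cos c) - (prod_cf s t c - cos c)); last by ring.
    by rewrite (le_trans (ler_normB _ _))// lerD.
  (* Two uses of the recursion turn [(s, t)] into [(s / 2, t / 2)], which gains one factor 2 in the
     bound. *)
  have := step _ _ _ parts_cf_rec prod_cf_rec
    (step _ _ _ parts_cf_rec prod_cf_rec IHn) s t c.
  suff -> : 2 * (`|s / 2| + `|t / 2|) / 2 ^+ n = 2 * (`|s| + `|t|) / 2 ^+ n.+1 by [].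
  have h2 : `|2^-1 : R| = 2^-1 by rewrite ger0_norm.
  rewrite !normrM h2 exprS; field.
  by rewrite expf_neq0.
apply/eqP; rewrite -subr_eq0 -normr_eq0 eq_le normr_ge0 andbT.
have h2 : 2 * (`|s| + `|t|) * 2^-1 ^+ n @[n --> \oo] --> (0 : R).
  rewrite -[X in _ --> X](mulr0 (2 * (`|s| + `|t|))); apply: cvgM; first exact: cvg_cst.
  by apply: cvg_expr; rewrite ger0_norm ?invr_ge0// invf_lt1// ltr1n.
rewrite -(cvg_lim _ h2)//; apply: limr_ge; first exact: cvgP h2.
by apply: nearW => n; rewrite exprVn; exact: h.
Qed.

(** By uniqueness of characteristic functions the joint law of the two parts is the product of two
    uniform laws: they are independent and uniform. *)
Lemma Rintegral_parts (h : R * R -> R) : bmf h ->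
  \int[P]_x h (even_part x, odd_part x) = \int[P]_x \int[P]_y h (x, y).
Proof.
move=> bh.
have mp : measurable_fun setT (fun x : R => (even_part x, odd_part x)).
  by apply/measurable_fun_pairP; split; [exact: measurable_even_part|exact: measurable_odd_part].
have [Q [_ Qint]] := @law_ex _ _ (measurableTypeR R)
   (measurableTypeR R * measurableTypeR R)%type _ P _ mp.
rewrite -(Qint h bh) -(@Rintegral_prod1 _ _ _ _ _ P P h bh).
apply: eq_measure_Rintegral.
apply: (@characteristic_function_unique _ (measurableTypeR R * measurableTypeR R)%type R
   [set X : R * R -> R | exists s t : R, X = fun z => s * z.1 + t * z.2] Q (P \x P)%E).
- by exists (fun z => 0 * z.1 + 0 * z.2); exists 0, 0.
- move=> a _ _ [s [t ->]] [s' [t' ->]]; exists (a * s + s'), (a * t + t').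
  by apply/funext => x; ring.
- set G := [set A | _].
  have m1 : measurable_fun [set: g_sigma_algebraType G] (fun z : R * R => z.1).
    apply: measurable_fun_gt => a; apply: sub_sigma_algebra.
    exists (fun z => 1 * z.1 + 0 * z.2); first by exists 1, 0.
    by exists a; apply/seteqP; split=> z /=; rewrite mul1r mul0r addr0.
  have m2 : measurable_fun [set: g_sigma_algebraType G] (fun z : R * R => z.2).
    apply: measurable_fun_gt => a; apply: sub_sigma_algebra.
    exists (fun z => 0 * z.1 + 1 * z.2); first by exists 0, 1.
    by exists a; apply/seteqP; split=> z /=; rewrite mul1r mul0r add0r.
  apply/seteqP; split.
    rewrite [X in X `<=` _]measurable_prod_measurableType; apply: smallest_sub.
      exact: smallest_sigma_algebra.
    move=> _ [A mA [B mB <-]].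
    have := @measurableI _ (g_sigma_algebraType G) _ _ (m1 measurableT A mA) (m2 measurableT B mB).
    by rewrite !setTI.
  apply: smallest_sub; first exact: sigma_algebra_measurable.
  move=> _ [_ [s [t ->]] [a ->]].
  rewrite -preimage_itvoy -[X in measurable X]setTI.
  have : measurable_fun setT (fun z : R * R => s * z.1 + t * z.2 + 0) by exact: mlin2.
  by under eq_fun do rewrite addr0; apply.
- move=> _ c [s [t ->]].
  have bc : bmf (fun z : R * R => cos (s * z.1 + t * z.2 + c)).
    exact/bmf_cos/mlin2.
  rewrite (Qint _ bc) (@Rintegral_prod1 _ _ _ _ _ P P _ bc)/=; exact: parts_cfE.
Qed.

End binary_digits.

(** * Inverse transform sampling *)

Section quantile_function.
Context (R : realType) (G : probability (measurableTypeR R) R).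
Local Notation P := (unif R).

Let cdfG (x : R) : R := fine (G `]-oo, x]%classic).

Let cdfG_nd x y : x <= y -> cdfG x <= cdfG y.
Proof.
move=> xy; rewrite fine_le ?fin_num_measure// le_measure ?inE//.
exact: subitvPr.
Qed.

Let cdfG_lim : [/\ cdfG x @[x --> +oo] --> (1 : R), cdfG x @[x --> -oo] --> (0 : R) &
  forall a, cdfG x @[x --> a^'+] --> cdfG a].
Proof.
pose X := HB.pack_for {mfun (measurableTypeR R) >-> R} (@idfun R)
  (isMeasurableFun.Build _ _ (measurableTypeR R) R (@idfun R) (@measurable_id _ _ setT)).
split.
- by apply: fine_cvg; exact: (@cvg_cdfy1 _ _ _ G X).
- by apply: fine_cvg; exact: (@cvg_cdfNy0 _ _ _ G X).
- move=> a; apply: fine_cvg; rewrite fineK ?fin_num_measure//.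
  exact: (@cdf_right_continuous _ _ _ G X a).
Qed.

(** Outside []0, 1[] the set may be empty or unbounded below; the value 0 is then a convention, on a
    null set of the uniform law. *)
Definition quantile (u : R) : R :=
  if 0 < u < 1 then inf [set x | u <= cdfG x] else 0.

(** From left to right this is right continuity: if [cdfG x < u], then [cdfG y < u] for some
    [y > x], and monotonicity keeps the infimum at or above [y]. *)
Let quantile_le u x : 0 < u < 1 -> (quantile u <= x) = (u <= cdfG x).
Proof.
move=> u01; rewrite /quantile u01; have /andP[u0 u1] := u01.
have [h1 h0 hr] := cdfG_lim.
have [m Fm] : exists m, cdfG m < u.
  have n0 : \forall t \near -oo, cdfG t < u by exact: (cvgr_lt _ h0 u u0).
  by have [m] := filter_ex n0; exists m.
have [M FM] : exists M, u < cdfG M.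
  have n1 : \forall t \near +oo, u < cdfG t by exact: (cvgr_gt _ h1 u u1).
  by have [M] := filter_ex n1; exists M.
have lbA : lbound [set x | u <= cdfG x] m.
  move=> y /= uy; rewrite leNgt; apply/negP => ym.
  by move: (le_lt_trans (le_trans uy (cdfG_nd (ltW ym))) Fm); rewrite ltxx.
have hA : has_inf [set x | u <= cdfG x] by split; [exists M; exact: ltW|exists m].
apply/idP/idP => [qx|]; last by move=> ux; apply: ge_inf => //; exists m.
rewrite leNgt; apply/negP => xu.
have near_lt : \forall t \near x^'+, cdfG t < u by exact: (cvgr_lt _ (hr x) u xu).
have [y [xy Fy]] : exists y, x < y /\ cdfG y < u.
  have n2 : \forall y \near x^'+, x < y /\ cdfG y < u.
    near=> y; split; near: y; [exact: nbhs_right_gt|exact: near_lt].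
  by have [y] := filter_ex n2; exists y.
have /inf_adherent : 0 < y - x by rewrite subr_gt0.
move=> /(_ _ hA)[z /= uz zy].
have : z < y by rewrite (lt_le_trans zy)// -lerBrDr opprB addrCA subrr addr0.
move=> /ltW/cdfG_nd/(le_trans uz); rewrite leNgt Fy//.
Unshelve. all: by end_near. Qed.

Lemma measurable_quantile : measurable_fun setT quantile.
Proof.
apply: measurable_fun_gt => a.
rewrite (_ : [set x | _] = (`]0%R, 1%R[%classic `&` `]cdfG a, +oo[%classic) `|`
   (~` `]0%R, 1%R[%classic `&` [set _ | a < 0])); last first.
  apply/seteqP; split=> u /=; rewrite !in_itv/= andbT.
    case: (boolP (0 < u < 1)) => [u01|nu].
      by rewrite ltNge quantile_le// -ltNge => ?; left.
    by rewrite /quantile (negbTE nu) => a0; right.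
  move=> [[u01]|[/negP nu]].
    by rewrite ltNge => ?; rewrite ltNge quantile_le.
  by rewrite /quantile (negbTE nu).
apply: measurableU; apply: measurableI => //; first exact: measurableC.
by case: (boolP (a < 0)) => a0; [rewrite (_ : [set _ | _] = setT)|rewrite (_ : [set _ | _] = set0)];
  rewrite //; apply/seteqP; split.
Qed.

(** By [quantile_le] the event [quantile u <= x] is [u <= cdfG x], of uniform probability [cdfG x].
    The two laws thus agree on half-lines, which generate the Borel sets and are stable under
    intersection. *)
Lemma Rintegral_quantile (f : R -> R) : bmf f ->
  \int[P]_u f (quantile u) = \int[G]_x f x.
Proof.
move=> bf.
have [Q [QE Qint]] := @law_ex _ _ (measurableTypeR R) (measurableTypeR R) _ P _ measurable_quantile.
rewrite -(Qint f bf).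
apply: (@eq_measure_Rintegral _ (measurableTypeR R) R Q G).
have QG x : Q `]x, +oo[%classic = G `]x, +oo[%classic.
  have e (H : probability (measurableTypeR R) R) :
      H `]x, +oo[%classic = (1 - H `]-oo, x]%classic)%E.
    by rewrite -setCitvl probability_setC.
  rewrite !e; congr (_ - _)%E; rewrite QE.
  have F01 : 0 <= cdfG x <= 1.
    rewrite /cdfG fine_ge0//=.
    by rewrite -[leRHS]/(fine 1%E) fine_le ?fin_num_measure// probability_le1.
  have mq : measurable (quantile @^-1` `]-oo, x]%classic).
    by rewrite -[X in measurable X]setTI; exact: measurable_quantile.
  have bi A : measurable A -> bmf (\1_A : R -> R).
    move=> mA; split; first exact: measurable_indic.
    by exists 1 => y; rewrite indicE; case: (_ \in _); rewrite ?normr1 ?normr0.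
  suff Pq : fine (P (quantile @^-1` `]-oo, x]%classic)) = cdfG x.
    by rewrite -[LHS]fineK ?fin_num_measure// Pq fineK ?fin_num_measure.
  rewrite -(Rintegral_indic P mq).
  transitivity (\int[P]_u (\1_(`]-oo, cdfG x]%classic) u : R)).
    apply: eq_Rintegral_ae; [exact: bi|exact: bi|].
    apply: (ae_imply _ (@unif_ae R)) => u u01.
    rewrite !indicE; congr (_%:R); congr nat_of_bool.
    by apply/idP/idP; rewrite !inE/= !in_itv/= quantile_le.
  rewrite Rintegral_unif; last exact: bi.
  rewrite /Rintegral integral_indic// (_ : _ `&` _ = `[0%R, cdfG x]%classic).
    have l (c : R) : 0 <= c -> lebesgue_measure `[0%R, c]%classic = c%:E.
      rewrite lebesgue_measure_itv/= lte_fin le_eqVlt.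
      by move=> /orP[/eqP <-|->]; rewrite ?ltxx// -EFinB subr0.
    by rewrite -[RHS]/(fine (cdfG x)%:E); congr fine; apply: l; have /andP[] := F01.
  apply/seteqP; split=> y /=; rewrite !in_itv/=.
    by move=> [-> /andP[->]].
  move=> /andP[y0 yF]; split=> //; rewrite y0 (le_trans yF)//.
  by have /andP[] := F01.
have hI : setI_closed (@RGenOInfty.G R).
  move=> _ _ [x ->] [y ->]; exists (Num.max x y).
  apply/seteqP; split=> z /=; rewrite !in_itv/= !andbT gt_max.
    by move=> [-> ->].
  by move=> /andP[].
have hT : \bigcup_n `]- n%:R, +oo[%classic = [set: R].
  apply/seteqP; split=> // x _; exists (Num.trunc `|x|).+1 => //=.
  rewrite in_itv/= andbT ltrNl (le_lt_trans _ (truncnS_gt `|x|))//.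
  by rewrite -normrN ler_norm.
have hg n : @RGenOInfty.G R `](- n%:R)%R, +oo[%classic by exists (- n%:R).
have QG' A : @RGenOInfty.G R A -> Q A = G A by move=> [x ->]; exact: QG.
have hfin n : (Q `](- n%:R)%R, +oo[%classic < +oo)%E.
  by rewrite (le_lt_trans (probability_le1 _ _))// ltry.
exact: (@measure_unique _ R (measurableTypeR R) _ _ (RGenOInfty.measurableE R)
  hI hg hT Q G QG' hfin).
Qed.

End quantile_function.

(** * A sequence of independent standard normal variables *)

Section gaussian_sequence.
Context (R : realType).
Local Notation P := (unif R).
Local Notation G := (@normal_prob R 0 1).

(* [odd_part] is independent of [even_part] and has the same law: iterating it
   produces independent uniform variables. *)
Definition gauss_seq (k : nat) (x : R) : R :=
  quantile G (even_part (iter k (@odd_part R) x)).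

Lemma gauss_seqS k x : gauss_seq k.+1 x = gauss_seq k (odd_part x).
Proof. by rewrite /gauss_seq iterSr. Qed.

Lemma measurable_gauss_seq k : measurable_fun setT (gauss_seq k).
Proof.
apply: (measurableT_comp (measurable_quantile G)).
apply: (measurableT_comp (@measurable_even_part R)).
elim: k => [|k IHk] /=; first exact: measurable_id.
exact: (measurableT_comp (@measurable_odd_part R) IHk).
Qed.

(** Induction on [n]: the first variable is a function of the even part, the later ones are
    functions of the odd part. The first is integrated with the others frozen, and their sum then
    acts as a phase. *)
Lemma gauss_seq_cf n (t : nat -> R) (c : R) :
  \int[P]_x cos (\sum_(k < n) t k * gauss_seq k x + c) =
  expR (- ((\sum_(k < n) t k ^+ 2) / 2)) * cos c.
Proof.
elim: n t c => [|n IHn] t c.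
  under eq_Rintegral do rewrite big_ord0 add0r.
  by rewrite Rintegral_cst1 big_ord0 mul0r oppr0 expR0 mul1r.
pose h (z : R * R) := cos (t 0%N * quantile G z.1 +
  \sum_(k < n) t k.+1 * gauss_seq k z.2 + c).
have ms m (u : nat -> R) : measurable_fun setT (fun y => \sum_(k < m) u k * gauss_seq k y).
  apply: measurable_sum => k; apply: measurable_funM => //.
  exact: measurable_gauss_seq.
have bh : bmf h.
  apply: bmf_cos; apply: measurable_funD => //; apply: measurable_funD.
    apply: measurable_funM => //.
    exact: (measurableT_comp (measurable_quantile G) measurable_fst).
  exact: (measurableT_comp (ms n (fun k => t k.+1)) measurable_snd).
transitivity (\int[P]_x h (even_part x, odd_part x)).
  apply: eq_Rintegral => x _; rewrite /h big_ord_recl/=; congr (cos (_ + _ + _)).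
  by apply: eq_bigr => k _; rewrite -gauss_seqS.
rewrite Rintegral_parts// -(@Rintegral_prod1 _ _ _ _ _ P P h bh) Rintegral_prod2//.
transitivity (\int[P]_y (expR (- (t 0%N ^+ 2 / 2)) *
    cos (\sum_(k < n) t k.+1 * gauss_seq k y + c))).
  apply: eq_Rintegral => y _; rewrite /h/=.
  rewrite -normal_characteristic_function.
  rewrite -(@Rintegral_quantile R G (fun x => cos (t 0%N * x + _))).
    by apply: eq_Rintegral => x _; rewrite addrA.
  by apply: bmf_cos; apply: measurable_funD => //; exact: measurable_funM.
rewrite RintegralZl//; last first.
  by apply: bmf_integrable; apply: bmf_cos; apply: measurable_funD => //; exact: (ms n (fun k => t k.+1)).
rewrite (IHn (fun k => t k.+1)) mulrA -expRD big_ord_recl; congr (expR _ * _).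
by rewrite -opprD -mulrDl.
Qed.

End gaussian_sequence.

(** * Orthonormal bases and the isonormal process *)

Section hilbert_space.
Context (R : realType) (E : hilbertType R).
Implicit Types x y z : E.

Lemma inner_sym x y : inner x y = inner y x.
Proof. by rewrite hermC expr0 mul1r. Qed.

Lemma innerDl x y z : inner (x + y) z = inner x z + inner y z.
Proof. exact: linearDl. Qed.

Lemma innerZl (a : R) x y : inner (a *: x) y = a * inner x y.
Proof. by rewrite linearZl_LR. Qed.

Lemma innerDr x y z : inner z (x + y) = inner z x + inner z y.
Proof. by rewrite inner_sym innerDl !(inner_sym z). Qed.

Lemma innerZr (a : R) x y : inner x (a *: y) = a * inner x y.
Proof. by rewrite inner_sym innerZl inner_sym. Qed.

Lemma inner0l y : inner 0 y = 0.
Proof. by rewrite -(scale0r 0) innerZl mul0r. Qed.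

Lemma inner0r y : inner y 0 = 0.
Proof. by rewrite inner_sym inner0l. Qed.

Lemma innerNl x y : inner (- x) y = - inner x y.
Proof. by rewrite -scaleN1r innerZl mulN1r. Qed.

Lemma innerBl x y z : inner (x - y) z = inner x z - inner y z.
Proof. by rewrite innerDl innerNl. Qed.

Lemma inner_suml (I : Type) (s : seq I) (P : pred I) (F : I -> E) y :
  inner (\sum_(i <- s | P i) F i) y = \sum_(i <- s | P i) inner (F i) y.
Proof.
elim: s => [|i s IHs]; first by rewrite !big_nil inner0l.
by rewrite !big_cons; case: (P i); rewrite ?innerDl IHs.
Qed.

Lemma inner_ge0 x : 0 <= inner x x.
Proof.
have [->|x0] := eqVneq x 0; first by rewrite inner0l.
by apply: ltW; exact: neq0_dnorm_gt0.
Qed.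

Lemma normr_innerX x : `|x| ^+ 2 = inner x x.
Proof. by rewrite normr_inner sqr_sqrtr// inner_ge0. Qed.

Lemma cauchy_schwarz x y : `|inner x y| <= `|x| * `|y|.
Proof.
have [->|y0] := eqVneq y 0; first by rewrite inner0r !normr0 mulr0.
have yy0 : 0 < inner y y by exact: neq0_dnorm_gt0.
have := inner_ge0 (x - (inner x y / inner y y) *: y).
rewrite innerBl !innerZl innerDr (inner_sym x (- _)) innerNl innerZl.
rewrite (inner_sym y (_ - _)) innerBl innerZl (inner_sym y x).
rewrite divfK ?gt_eqF// subrr mulr0 subr0 subr_ge0 => h.
rewrite -(@ler_pXn2r _ 2)// ?nnegrE// ?mulr_ge0//.
rewrite exprMn !normr_innerX real_normK ?num_real//.
by rewrite -ler_pdivrMr// expr2 mulrAC.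
Qed.

Lemma cvg_inner (T : Type) (F : set_system T) {FF : Filter F} (f : T -> E) x y :
  f @ F --> x -> inner (f t) y @[t --> F] --> inner x y.
Proof.
move=> fx; apply/cvgrPdist_le => /= r r0.
have r1 : 0 < r / (`|y| + 1) by rewrite divr_gt0// ltr_wpDl.
move/cvgrPdist_le : fx => /(_ _ r1); apply: filterS => t ft.
rewrite -innerBl (le_trans (cauchy_schwarz _ _))//.
rewrite (le_trans (ler_wpM2r _ ft))// -mulrA ler_piMr ?ltW//.
by rewrite mulrC ltr_pdivrMr ?mul1r ?ltrDl// ltr_wpDl.
Qed.

Variables (e : nat -> E) (eB : orthonormal_basis e).

Let ee i j : inner (e i) (e j) = (i == j)%:R := eB.1 i j.

Lemma inner_sum_basis m n (c : nat -> R) j :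
  inner (\sum_(m <= k < n) c k *: e k) (e j) = if (m <= j < n)%N then c j else 0.
Proof.
rewrite inner_suml; under eq_bigr do rewrite innerZl ee.
case: ifPn => mjn.
  rewrite (bigD1_seq j) ?mem_index_iota ?iota_uniq//= eqxx mulr1 big1 ?addr0//.
  by move=> i ij; rewrite (negbTE ij) mulr0.
rewrite big_nat big1// => i imn; case: eqP => [ij|]; last by rewrite mulr0.
by move: mjn; rewrite -ij imn.
Qed.

Lemma normr_sum_basis m n (c : nat -> R) :
  `|\sum_(m <= k < n) c k *: e k| ^+ 2 = \sum_(m <= k < n) c k ^+ 2.
Proof.
rewrite normr_innerX {1}inner_suml big_nat [RHS]big_nat; apply: eq_bigr => j jmn.
by rewrite innerZl inner_sym inner_sum_basis jmn expr2.
Qed.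

Lemma pythagoras_basis n x :
  `|x - \sum_(0 <= k < n) inner x (e k) *: e k| ^+ 2 =
  `|x| ^+ 2 - \sum_(0 <= k < n) inner x (e k) ^+ 2.
Proof.
set p := \sum_(0 <= k < n) _ *: _.
have xp : inner x p = inner p p.
  rewrite (inner_sym x) {1 2}/p !inner_suml; apply: eq_big_nat => j jn.
  by rewrite !innerZl (inner_sym _ p) inner_sum_basis jn (inner_sym _ x).
rewrite -normr_sum_basis -/p !normr_innerX innerBl (inner_sym x) (inner_sym p).
by rewrite !innerBl (inner_sym p x) xp subrr subr0.
Qed.

Lemma bessel n x : \sum_(0 <= k < n) inner x (e k) ^+ 2 <= `|x| ^+ 2.
Proof. by rewrite -subr_ge0 -pythagoras_basis exprn_ge0. Qed.

(** Let [p] be the projection on the first [n] vectors. By density some [y] in the finite span is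
    close to [x]; once [p y = y], the remainder [x - p x] equals [(x - y) - p (x - y)], of norm at
    most [|x - y|]. *)
Lemma cvg_basis x : \sum_(0 <= k < n) inner x (e k) *: e k @[n --> \oo] --> x.
Proof.
apply/cvgrPdist_lt => /= r r0.
have [y [/= xy [s [c ye]]]] : exists y, ball x r y /\ finite_span e y.
  have := eB.2 (ball x r) _ (ball_open x r).
  by case=> [|y [xy ys]]; [exists x; exact: ballxx|exists y].
(* Beyond every index occurring in [y], so that the projection fixes [y]. *)
exists (\max_(i <- s) i.+1)%N => // n /= sn.
pose p z := \sum_(0 <= k < n) inner z (e k) *: e k.
have pD a u v : p (a *: u + v) = a *: p u + p v.
  rewrite /p scaler_sumr -big_split/=; apply: eq_bigr => k _.
  by rewrite innerDl innerZl scalerDl scalerA.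
have pe i : (i < n)%N -> p (e i) = e i.
  move=> ilt; rewrite /p (bigD1_seq i) ?mem_index_iota ?iota_uniq//= ee eqxx scale1r.
  rewrite big1 ?addr0// => k ki; by rewrite ee eq_sym (negbTE ki) scale0r.
have p0 : p 0 = 0 by rewrite /p big1// => k _; rewrite inner0l scale0r.
have py : p y = y.
  rewrite ye; elim: s {ye} sn => [|i s IHs] sn; first by rewrite big_nil.
  rewrite big_cons pD IHs ?pe//.
    by rewrite (leq_trans _ sn)// big_cons leq_max ltnSn.
  by rewrite (leq_trans _ sn)// big_cons leq_max leqnn orbT.
rewrite -/(p x) (_ : x - p x = (x - y) - p (x - y)); last first.
  have -> : p (x - y) = p x - y.
    by rewrite -(scaleN1r y) addrC pD py scaleN1r addrC.
  by rewrite opprB addrA addrNK.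
apply: (@le_lt_trans _ _ `|x - y|); last by move: xy; rewrite -ball_normE.
rewrite -(@ler_pXn2r _ 2)// ?nnegrE// pythagoras_basis.
by rewrite gerBl sumr_ge0// => k _; rewrite sqr_ge0.
Qed.

Lemma parseval x : \sum_(0 <= k < n) inner x (e k) ^+ 2 @[n --> \oo] --> `|x| ^+ 2.
Proof.
under eq_fun do rewrite -normr_sum_basis.
by apply: cvgM; apply: cvg_norm; exact: cvg_basis.
Qed.

Lemma basis_inj x y : (forall n, inner x (e n) = inner y (e n)) -> x = y.
Proof.
move=> xy; have hx := @cvg_basis x; have hy := @cvg_basis y.
have hE : (fun n => \sum_(0 <= k < n) inner x (e k) *: e k) =
          (fun n => \sum_(0 <= k < n) inner y (e k) *: e k).
  by apply/funext => n; apply: eq_bigr => k _; rewrite xy.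
by rewrite hE in hx; exact: (cvg_unique _ hx hy).
Qed.

(** A block of the vector series has as squared norm the same block of [sum c_k^2], so the Cauchy
    criterion for [r] follows from the numerical one for [r^2]. *)
Lemma riesz_fischer (c : nat -> R) (M : R) :
  (forall n, \sum_(0 <= k < n) c k ^+ 2 <= M) ->
  exists y, forall n, inner y (e n) = c n.
Proof.
move=> cM.
have c2 : cvgn (series (fun k => c k ^+ 2)).
  apply: nondecreasing_is_cvgn.
    by apply: nondecreasing_series => k _ _; exact: sqr_ge0.
  by exists M => _ [n _ <-]; exact: cM.
have cc : cvgn (series (fun k => c k *: e k)).
  apply: cauchy_cvg; apply/cauchy_seriesP => r r0.
  have h := (cauchy_seriesP _).1 (@cvg_cauchy _ _ _ c2) (r ^+ 2).
  have {}h := h ltac:(exact _) (exprn_gt0 _ r0).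
  apply: filterS h => -[m n] /=.
  rewrite ger0_norm ?sumr_ge0// => [|k _]; last exact: sqr_ge0.
  by rewrite -normr_sum_basis ltr_pXn2r ?nnegrE// ltW.
exists (lim (series (fun k => c k *: e k) @ \oo)) => n.
have h1 := cvg_inner (y := e n) cc.
have h2 : inner (series (fun k => c k *: e k) m) (e n) @[m --> \oo] --> c n.
  apply: cvg_near_cst; exists n.+1 => // m /= nm.
  by rewrite inner_sum_basis nm.
exact: (cvg_unique _ (h1 _) h2).
Qed.

End hilbert_space.

Lemma nneseries_ltyP (R : realType) (u : nat -> R) : (forall n, 0 <= u n) ->
  (\sum_(0 <= n <oo) (u n)%:E < +oo)%E <->
  exists M, forall n, \sum_(0 <= k < n) u k <= M.
Proof.
move=> u0; have u0E n : (0 <= (u n)%:E)%E by rewrite lee_fin.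
split=> [su|[M uM]].
  exists (fine (\sum_(0 <= n <oo) (u n)%:E)%E) => n.
  rewrite -lee_fin fineK; last first.
    by rewrite ge0_fin_numE//; apply: nneseries_ge0.
  by rewrite -sumEFin; apply: nneseries_lim_ge => k _ _; exact: u0E.
apply: (@le_lt_trans _ _ M%:E); last exact: ltry.
apply: lime_le; first by apply: is_cvg_nneseries => k _ _; exact: u0E.
by apply: nearW => n; rewrite sumEFin lee_fin.
Qed.

(** * Fatou's lemma, summability and mean-square estimates *)

Section integral_limits.
Context d (T : measurableType d) (R : realType) (mu : probability T R).

Lemma integral_lim_le (f : nat -> T -> R) (g : T -> R) (C : \bar R) :
  (forall n, measurable_fun setT (f n)) -> measurable_fun setT g ->
  (forall n x, 0 <= f n x) -> (forall x, 0 <= g x) ->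
  {ae mu, forall x, f ^~ x @ \oo --> g x} ->
  (forall n, (\int[mu]_x (f n x)%:E <= C)%E) ->
  (\int[mu]_x (g x)%:E <= C)%E.
Proof.
move=> mf mg f0 g0 fg fC.
have mF n : measurable_fun setT (fun x => (f n x)%:E) by exact/measurable_EFinP.
have F0 n x : setT x -> (0 <= (f n x)%:E)%E by rewrite lee_fin.
have linf (u : nat -> \bar R) (c : \bar R) : (forall n, (c <= u n)%E) -> (c <= limn_einf u)%E.
  move=> cu; rewrite limn_einf_lim; apply: lime_ge; first exact: is_cvg_einfs.
  by apply: nearW => n; apply: le_ereal_inf_tmp => _ [m _ <-].
have linfC : (limn_einf (fun n => \int[mu]_x (f n x)%:E) <= C)%E.
  rewrite limn_einf_lim; apply: lime_le; first exact: is_cvg_einfs.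
  apply: nearW => n; rewrite (le_trans _ (fC n))//.
  by apply: ereal_inf_lbound; exists n => /=.
apply: le_trans linfC; apply: le_trans (fatou mu measurableT mF F0).
apply: ae_ge0_le_integral => //.
- by move=> x _; rewrite lee_fin.
- exact/measurable_EFinP.
- by move=> x _; apply: linf => n; exact: F0.
- apply: (measurableT_comp (f := -%E)) => //.
  apply: (measurable_fun_limn_esup (f := fun n x => - (f n x)%:E)%E) => n.
  exact: (measurableT_comp (f := -%E)).
- apply: filterS fg => x fx _.
  have cfx : (fun n => (f n x)%:E) @ \oo --> (g x)%:E.
    by apply: cvg_EFin => //; exact: nearW.
  rewrite is_cvg_limn_einfE; last by apply/cvg_ex; eexists; exact: cfx.
  by rewrite (cvg_lim _ cfx).
Qed.

Lemma measurable_summable (u : nat -> T -> R) :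
  (forall n, measurable_fun setT (u n)) -> (forall n x, 0 <= u n x) ->
  measurable [set x | (\sum_(0 <= n <oo) (u n x)%:E < +oo)%E].
Proof.
move=> mu_ u0; rewrite -[X in measurable X]setTI.
apply: emeasurable_fun_infty_o => //; apply: ge0_emeasurable_sum => [n x _ _|n _].
  by rewrite lee_fin.
exact/measurable_EFinP.
Qed.

(** By monotone convergence the sum has a finite integral, hence is finite almost everywhere. *)
Lemma ae_summable (u : nat -> T -> R) (c : nat -> R) :
  (forall n, measurable_fun setT (u n)) -> (forall n x, 0 <= u n x) ->
  (forall n, (\int[mu]_x (u n x)%:E <= (c n)%:E)%E) ->
  (\sum_(0 <= n <oo) (c n)%:E < +oo)%E ->
  {ae mu, forall x, (\sum_(0 <= n <oo) (u n x)%:E < +oo)%E}.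
Proof.
move=> mu_ u0 uc cfin.
have mF n : measurable_fun setT (fun x => (u n x)%:E) by exact/measurable_EFinP.
have S0 x : (0 <= \sum_(0 <= n <oo) (u n x)%:E)%E.
  by apply: nneseries_ge0 => n _ _; rewrite lee_fin.
have mS : measurable_fun setT (fun x => \sum_(0 <= n <oo) (u n x)%:E)%E.
  by apply: ge0_emeasurable_sum => // n x _ _; rewrite lee_fin.
have iS : mu.-integrable setT (fun x => \sum_(0 <= n <oo) (u n x)%:E)%E.
  apply/integrableP; split => //.
  under eq_integral do rewrite gee0_abs//.
  rewrite integral_nneseries//; last by move=> n x _; rewrite lee_fin.
  apply: le_lt_trans cfin; apply: lee_nneseries => // n _.
  by move=> _; apply: integral_ge0 => x _; rewrite lee_fin.
apply: filterS (integrable_ae measurableT iS) => x /(_ I).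
by rewrite ge0_fin_numE.
Qed.

Lemma integral_sqr_eq0 (f : T -> R) : measurable_fun setT f ->
  (forall r, 0 < r -> (\int[mu]_x ((f x) ^+ 2)%:E <= r%:E)%E) ->
  {ae mu, forall x, f x = 0}.
Proof.
move=> mf fr.
have mf2 : measurable_fun setT (fun x => ((f x) ^+ 2)%:E).
  by apply/measurable_EFinP; exact: measurable_funX.
have i0 : (\int[mu]_x `|((f x) ^+ 2)%:E| = 0)%E.
  under eq_integral do rewrite gee0_abs ?lee_fin ?sqr_ge0//.
  apply/eqP; rewrite eq_le; apply/andP; split; last first.
    by apply: integral_ge0 => x _; rewrite lee_fin sqr_ge0.
  by apply/lee_addgt0Pr => r r0; rewrite add0e; exact: fr.
apply: filterS ((ae_eq_integral_abs mu measurableT mf2).1 i0) => x /(_ I)/= [] /eqP.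
by rewrite sqrf_eq0 => /eqP.
Qed.

Lemma integral_sqrD (f g h : T -> R) (a b s t : R) :
  measurable_fun setT f -> measurable_fun setT g -> measurable_fun setT h ->
  0 <= s -> 0 <= t ->
  (forall x, h x ^+ 2 <= s * f x ^+ 2 + t * g x ^+ 2) ->
  (\int[mu]_x ((f x) ^+ 2)%:E <= a%:E)%E -> (\int[mu]_x ((g x) ^+ 2)%:E <= b%:E)%E ->
  (\int[mu]_x ((h x) ^+ 2)%:E <= (s * a + t * b)%:E)%E.
Proof.
move=> mf mg mh s0 t0 hfg fa gb.
have m2 (k : T -> R) : measurable_fun setT k -> measurable_fun setT (fun x => (k x ^+ 2)%:E).
  by move=> mk; apply/measurable_EFinP; exact: measurable_funX.
have mM (r : R) (k : T -> R) : measurable_fun setT k -> measurable_fun setT (fun x => (r%:E * (k x ^+ 2)%:E)%E).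
  by move=> mk; apply: measurable_funeM; exact: m2.
apply: (@le_trans _ _ (\int[mu]_x (s%:E * ((f x) ^+ 2)%:E + t%:E * ((g x) ^+ 2)%:E))%E).
  apply: ge0_le_integral => //.
  - by move=> x _; rewrite lee_fin sqr_ge0.
  - exact: m2.
  - by apply: emeasurable_funD; exact: mM.
  - by move=> x _; rewrite -!EFinM -EFinD lee_fin hfg.
rewrite ge0_integralD//; last 4 first.
- by move=> x _; rewrite mule_ge0// lee_fin// sqr_ge0.
- exact: mM.
- by move=> x _; rewrite mule_ge0// lee_fin// sqr_ge0.
- exact: mM.
rewrite !ge0_integralZl//; try (by move=> x _; rewrite lee_fin sqr_ge0); try exact: m2.
by rewrite EFinD !EFinM; apply: leeD; apply: lee_wpmul2l; rewrite ?lee_fin.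
Qed.

End integral_limits.

Lemma cvg_square_sin (R : realType) (y : R) :
  4 * n.+1%:R ^+ 2 * sin (y / (2 * n.+1%:R)) ^+ 2 @[n --> \oo] --> y ^+ 2.
Proof.
(* The derivative of the sine at 0 is a limit over nonzero increments, which [y = 0] does not
   provide. *)
have [->|y0] := eqVneq y 0.
  rewrite expr0n/=; under eq_cvg => n do rewrite mul0r sin0 expr0n/= mulr0.
  exact: cvg_cst.
have ds : h^-1 * sin h @[h --> 0^'] --> (1 : R).
  have [/cvg_ex[l ls]] := is_derive_sin (0 : R).
  rewrite /derive (cvg_lim _ ls)// cos0 => l1.
  move: ls; rewrite l1; apply: cvg_trans; apply: near_eq_cvg; apply: nearW => h /=.
  by rewrite /GRing.scale/= mulr1 addr0 sin0 subr0.
have hn : y / (2 * n.+1%:R) @[n --> \oo] --> (0 : R)^'.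
  have h0 : y / (2 * n.+1%:R) @[n --> \oo] --> (0 : R).
    rewrite -[X in _ --> X](mulr0 (y / 2)).
    under eq_cvg => n do rewrite invfM mulrA.
    apply: cvgMr; exact: cvg_harmonic.
  move=> U /= U0; have : \forall n \near \oo, (fun x => x != 0 -> U x) (y / (2 * n.+1%:R)) := h0 _ U0.
  apply: filterS => n; apply.
  by rewrite /= mulf_neq0// invr_neq0// mulf_neq0.
have c1 := cvg_comp _ _ hn ds.
have -> : y ^+ 2 = y ^+ 2 * (1 * 1) by rewrite !mulr1.
apply: cvg_trans (cvgMr (cvgM c1 c1)).
apply: near_eq_cvg; apply: nearW => n /=.
set s := sin _; have : n.+1%:R != 0 :> R by [].
by move: (n.+1%:R : R) s => m s m0; field; rewrite m0 y0.
Qed.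

Section second_moment.
Context d (T : measurableType d) (R : realType) (mu : probability T R).

(* Fatou's lemma applied to [2 n^2 (1 - cos (f / n))], whose limit is [f^2]. *)
Lemma second_moment_le (f : T -> R) (s : R) : measurable_fun setT f -> 0 <= s ->
  (forall t, \int[mu]_x cos (t * f x) = expR (- (t ^+ 2 * s / 2))) ->
  (\int[mu]_x (f x ^+ 2)%:E <= s%:E)%E.
Proof.
move=> mf s0 cf.
pose g n x : R := 4 * n.+1%:R ^+ 2 * sin (f x / (2 * n.+1%:R)) ^+ 2.
have gE n : g n = fun x => - (2 * n.+1%:R ^+ 2) * cos (n.+1%:R^-1 * f x) + 2 * n.+1%:R ^+ 2.
  apply/funext => x; have -> : n.+1%:R^-1 * f x = f x / (2 * n.+1%:R) *+ 2.
    have n0 : n.+1%:R != 0 :> R by [].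
    by rewrite -mulr_natr; move: (n.+1%:R : R) n0 => m m0; field.
  by rewrite cos_mulr2n cos2sin2 /g; ring.
have mc n : bmf (fun x => cos (n.+1%:R^-1 * f x)).
  by apply: bmf_cos; apply: measurable_funM.
have bg n : bmf (g n).
  by rewrite gE; apply: bmfD; [exact/bmfZ|exact: bmf_cst].
have g0 n x : 0 <= g n x by apply: mulr_ge0 (sqr_ge0 _); apply: mulr_ge0 (sqr_ge0 _).
apply: (integral_lim_le (f := g)) => //.
- by move=> n; exact: (bg n).1.
- exact: measurable_funX.
- by move=> x; exact: sqr_ge0.
- by apply: nearW => x; exact: cvg_square_sin.
move=> n.
have intg : (\int[mu]_x (g n x)%:E)%E \is a fin_num.
  exact: (integrable_fin_num measurableT (bmf_integrable mu (bg n))).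
rewrite -(fineK intg) lee_fin -/(Rintegral mu setT (g n)).
rewrite gE RintegralZD//; last exact: bmf_cst.
rewrite Rintegral_cst1 cf.
have := expR_ge1Dx (- (n.+1%:R^-1 ^+ 2 * s / 2)).
have n0 : 0 < n.+1%:R :> R by [].
have n2 : n.+1%:R ^+ 2 * n.+1%:R ^- 2 = 1 :> R by rewrite mulfV// expf_neq0// gt_eqF.
rewrite exprVn; move: (expR _) => z hz.
have := ler_wpM2l (sqr_ge0 (n.+1%:R : R)) hz.
have -> : n.+1%:R ^+ 2 * (1 + - (n.+1%:R ^- 2 * s / 2)) = n.+1%:R ^+ 2 - s / 2 :> R.
  by rewrite mulrDr mulr1 mulrN !mulrA n2 mul1r.
lra.
Qed.

End second_moment.

(** * Almost sure and mean-square limits of Gaussian series *)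

Section gaussian_series.
Context d (T : measurableType d) (R : realType) (mu : probability T R).
Variable X : nat -> T -> R.
Hypothesis mX : forall k, measurable_fun setT (X k).
Hypothesis X_cf : forall n (t : nat -> R) c,
  \int[mu]_w cos (\sum_(0 <= k < n) t k * X k w + c) =
  expR (- ((\sum_(0 <= k < n) t k ^+ 2) / 2)) * cos c.
Implicit Types (c : nat -> R).

Lemma measurable_partial_sum c m n :
  measurable_fun setT (fun w => \sum_(m <= k < n) c k * X k w).
Proof.
by apply: measurable_sum => k; apply: measurable_funM.
Qed.

Lemma partial_sum_second_moment c m n :
  (\int[mu]_w ((\sum_(m <= k < n) c k * X k w) ^+ 2)%:E <=
   (\sum_(m <= k < n) c k ^+ 2)%:E)%E.
Proof.
apply: second_moment_le; first exact: measurable_partial_sum.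
  by apply: sumr_ge0 => k _; exact: sqr_ge0.
(* The coefficients below [m] are set to 0 because [X_cf] concerns sums starting at 0. *)
move=> t; pose a k := if (m <= k)%N then t * c k else 0.
have aE w : t * \sum_(m <= k < n) c k * X k w = \sum_(0 <= k < n) a k * X k w + 0.
  rewrite (big_nat_widenl _ 0%N)// big_mkcond/= mulr_sumr addr0.
  by apply: eq_bigr => k _; rewrite /a; case: ifP => _; rewrite ?mulr0 ?mul0r// mulrA.
have -> : t ^+ 2 * \sum_(m <= k < n) c k ^+ 2 = \sum_(0 <= k < n) a k ^+ 2.
  rewrite (big_nat_widenl _ 0%N)// big_mkcond/= mulr_sumr.
  apply: eq_bigr => k _; rewrite /a; case: ifP => _; last by rewrite expr0n mulr0.
  by rewrite exprMn.
rewrite (_ : (fun w => cos _) = fun w => cos (\sum_(0 <= k < n) a k * X k w + 0)).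
  by rewrite X_cf cos0 mulr1.
by apply/funext => w; rewrite aE.
Qed.

Let S c n w := \sum_(0 <= k < n) c k * X k w.
Let Q c n := \sum_(0 <= k < n) c k ^+ 2.

Let sum_geo n : \sum_(0 <= j < n) (2^-1 : R) ^+ j <= 2.
Proof.
have : \sum_(0 <= j < n) (2^-1 : R) ^+ j = 2 - 2 * 2^-1 ^+ n.
  elim: n => [|n IH]; first by rewrite big_geq// expr0; ring.
  by rewrite big_nat_recr//= IH exprS; field.
by move=> ->; rewrite lerBlDr lerDl mulr_ge0// exprn_ge0// invr_ge0.
Qed.

(** The blocks [D j] have second moment at most [4^-j], so [2^j D_j^2] has integral at most [2^-j]
    and its sum over [j] is almost surely finite. As [|D_j| <= 2^j D_j^2 + 2^-j], the blocks then
    form an absolutely convergent series. *)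
Lemma subsequence_ae_cvg c (N : nat -> nat) :
  {homo N : i j / (i <= j)%N} ->
  (forall j, \sum_(N j <= k < N j.+1) c k ^+ 2 <= 2^-1 ^+ j * 2^-1 ^+ j) ->
  exists2 h : T -> R, measurable_fun setT h &
    {ae mu, forall w, S c (N j) w @[j --> \oo] --> h w}.
Proof.
move=> homoN cN.
pose D j w := \sum_(N j <= k < N j.+1) c k * X k w.
pose u j w := 2 ^+ j * D j w ^+ 2.
have mD j : measurable_fun setT (D j) by exact: measurable_partial_sum.
have mu_ j : measurable_fun setT (u j).
  by apply: measurable_funM => //; exact: measurable_funX.
have u0 j w : 0 <= u j w by rewrite mulr_ge0 ?sqr_ge0 ?exprn_ge0.
have iu j : (\int[mu]_w (u j w)%:E <= (2^-1 ^+ j)%:E)%E.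
  under eq_integral do rewrite EFinM.
  rewrite ge0_integralZl//; last 2 first.
  - by apply/measurable_EFinP; exact: measurable_funX.
  - by move=> w _; rewrite lee_fin sqr_ge0.
  have -> : 2^-1 ^+ j = 2 ^+ j * (2^-1 ^+ j * 2^-1 ^+ j) :> R.
    by rewrite mulrA -exprMn mulfV// expr1n mul1r.
  rewrite EFinM; apply: lee_wpmul2l; first by rewrite lee_fin exprn_ge0.
  by apply: le_trans (partial_sum_second_moment _ _ _) _; rewrite lee_fin.
pose G := [set w | (\sum_(0 <= j <oo) (u j w)%:E < +oo)%E].
have aeG : {ae mu, forall w, G w}.
  apply: ae_summable iu _ => //.
  apply/nneseries_ltyP; first by move=> n; rewrite exprn_ge0// invr_ge0.
  by exists 2.
have mG : measurable G by exact: measurable_summable.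
have SD n w : S c (N n) w = S c (N 0%N) w + series (D ^~ w) n.
  elim: n => [|n IH]; first by rewrite /series/= big_geq// addr0.
  rewrite /series/= big_nat_recr//= addrA -[X in _ = X + _]IH.
  by rewrite /S (big_cat_nat _ (homoN n n.+1 (leqnSn _)))//.
have cvgG w : G w -> cvgn (fun j => S c (N j) w).
  move=> /nneseries_ltyP -/(_ (fun j => u0 j w)) [M uM].
  under eq_fun do rewrite SD.
  apply: is_cvgD; first exact: is_cvg_cst.
  apply: normed_cvg.
  apply: nondecreasing_is_cvgn; first by apply: nondecreasing_series => j _ _; exact: normr_ge0.
  exists (M + 2) => _ [n _ <-]; apply: le_trans (lerD (uM n) (sum_geo n)).
  rewrite -big_split/=; apply: ler_sum => j _.
  have p0 : 0 < 2^-1 ^+ j :> R by rewrite exprn_gt0.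
  have -> : u j w = (2^-1 ^+ j)^-1 * D j w ^+ 2 by rewrite /u exprVn invrK.
  move: (2^-1 ^+ j) p0 (D j w) => p p0 y.
  rewrite -real_normK ?num_real//; move: `|y| (normr_ge0 y) => z z0.
  (* The expanded square gives [z <= p^-1 z^2 + p], with [p = 2^-j] and [z] the absolute value of
     the block. *)
  have : 0 <= p * (p^-1 * z - 1) ^+ 2 + z by rewrite addr_ge0// mulr_ge0 ?sqr_ge0// ltW.
  suff -> : p * (p^-1 * z - 1) ^+ 2 + z = p^-1 * z ^+ 2 + p - z by rewrite subr_ge0.
  by field; rewrite gt_eqF.
(* Cutting off outside [G] makes the sequence converge everywhere, so that its limit is
   measurable. *)
pose v j w := \1_G w * S c (N j) w.
have vcvg w : cvgn (v ^~ w).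
  have [Gw|Gw] := pselect (G w).
    rewrite (_ : v ^~ w = fun j => S c (N j) w); first exact: cvgG.
    by apply/funext => j; rewrite /v indicE mem_set// mul1r.
  rewrite (_ : v ^~ w = fun=> 0); first exact: is_cvg_cst.
  by apply/funext => j; rewrite /v indicE memNset// mul0r.
exists (fun w => limn (v ^~ w)).
  apply: (@measurable_fun_cvg _ _ _ _ v) => [j|w _]; last exact: vcvg.
  apply: measurable_funM; first exact: measurable_indic.
  exact: measurable_partial_sum.
apply: filterS aeG => w Gw.
rewrite (_ : v ^~ w = fun j => S c (N j) w); first exact: cvgG.
by apply/funext => j; rewrite /v indicE mem_set// mul1r.
Qed.

(** The variable [h] is an almost sure limit along a subsequence; Fatou's lemma then bounds its
    distance to every partial sum, and bounded convergence carries the characteristic function to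
    it. *)
Lemma gaussian_series_cvg c (s : R) : Q c n @[n --> \oo] --> s ->
  exists h : T -> R, [/\ measurable_fun setT h,
    forall n, (\int[mu]_w ((h w - S c n w) ^+ 2)%:E <= (s - Q c n)%:E)%E &
    forall t a, \int[mu]_w cos (t * h w + a) = expR (- (t ^+ 2 * s / 2)) * cos a].
Proof.
move=> cs.
have ndQ : nondecreasing_seq (Q c).
  apply: nondecreasing_series => k _ _; exact: sqr_ge0.
have Qs n : Q c n <= s.
  rewrite -(cvg_lim _ cs)//; apply: nondecreasing_cvgn_le => //.
  by apply/cvg_ex; exists s.
have /choice[N0 N0P] : forall j, exists m, forall n, (m <= n)%N ->
    s - Q c n <= 2^-1 ^+ j * 2^-1 ^+ j.
  move=> j; have p0 : 0 < 2^-1 ^+ j * 2^-1 ^+ j :> R by rewrite mulr_gt0// exprn_gt0.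
  have [m _ mP] := (cvgrPdist_le _ _).1 cs _ p0.
  by exists m => n mn; have := mP _ mn; rewrite /= ger0_norm// subr_ge0.
(* Summing the successors of the [N0 i] makes [N] monotone and at least both [j] and [N0 j]. *)
pose N j := (\sum_(0 <= i < j.+1) (N0 i).+1)%N.
have homoN : {homo N : i j / (i <= j)%N}.
  move=> i j ij; rewrite /N [leqRHS](big_cat_nat _ (n := i.+1))//=; exact: leq_addr.
have Nge j : (j <= N j)%N.
  rewrite /N (@leq_trans (\sum_(0 <= i < j.+1) 1))//; first by rewrite sum_nat_const_nat muln1.
  exact: leq_sum.
have NN0 j : (N0 j <= N j)%N by rewrite /N big_nat_recr//= (leq_trans (leqnSn _))// leq_addl.
have sub m n : (m <= n)%N -> \sum_(m <= k < n) c k ^+ 2 = Q c n - Q c m.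
  by move=> mn; rewrite /Q (big_cat_nat (leq0n m) mn)//= [RHS]addrC addKr.
have [|h mh hcvg] := @subsequence_ae_cvg c N homoN.
  move=> j; rewrite sub ?homoN//; apply: le_trans (N0P j _ (NN0 j)).
  by rewrite lerD2r.
have Noo : N @ \oo --> \oo.
  by move=> U [m _ mU]; exists m => // j mj; apply: mU; exact: leq_trans mj (Nge j).
exists h; split => //; last first.
  move=> t a.
  have mS m : measurable_fun setT (fun w => t * S c m w + a).
    by apply: measurable_funD => //; apply: measurable_funM => //; exact: measurable_partial_sum.
  have cm (g : T -> R) : measurable_fun setT g -> measurable_fun setT (fun w => cos (g w)).
    by move=> /bmf_cos[].
  have limh : \int[mu]_w cos (t * S c (N j) w + a) @[j --> \oo] -->
      \int[mu]_w cos (t * h w + a).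
    apply: (bounded_convergence_ae (M := 1)).
    - by move=> j; apply: cm.
    - by apply: cm; apply: measurable_funD => //; exact: measurable_funM.
    - by move=> j w; rewrite ler_norml cos_geN1 cos_le1.
    - apply: filterS hcvg => w hw; apply: (continuous_cvg _ (@continuous_cos R _)).
      by apply: cvgD; [exact: cvgMr|exact: cvg_cst].
  have limQ : expR (- (t ^+ 2 * Q c (N j) / 2)) * cos a @[j --> \oo] -->
      expR (- (t ^+ 2 * s / 2)) * cos a.
    apply: cvgMl; apply: (continuous_cvg _ (@continuous_expR R _)).
    apply: cvgN; apply: cvgMl; apply: cvgMr.
    exact: (cvg_comp _ _ Noo cs).
  suff E j : \int[mu]_w cos (t * S c (N j) w + a) = expR (- (t ^+ 2 * Q c (N j) / 2)) * cos a.
    by rewrite (funext E) in limh; exact: cvg_unique limh limQ.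
  have -> : t ^+ 2 * Q c (N j) = \sum_(0 <= k < N j) (t * c k) ^+ 2.
    by rewrite /Q mulr_sumr; apply: eq_bigr => k _; rewrite exprMn.
  rewrite -X_cf; congr (Rintegral _ _ _); apply/funext => w.
  by rewrite /S mulr_sumr; congr (cos (_ + _)); apply: eq_bigr => k _; rewrite mulrA.
move=> n.
have mS m : measurable_fun setT (S c m) by exact: measurable_partial_sum.
(* As [N j >= j], the shift by [n] ensures [N (j + n) >= n], so each difference is a block starting
   at [n]. *)
apply: (integral_lim_le (f := fun j w => (S c (N (j + n)%N) w - S c n w) ^+ 2)).
- by move=> j; apply: measurable_funX; exact: measurable_funB.
- by apply: measurable_funX; exact: measurable_funB.
- by move=> j w; exact: sqr_ge0.
- by move=> w; exact: sqr_ge0.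
- apply: filterS hcvg => w hw.
  have hw' : S c (N (j + n)%N) w - S c n w @[j --> \oo] --> h w - S c n w.
    apply: cvgB; last exact: cvg_cst.
    by rewrite (cvg_shiftn n (fun j => S c (N j) w)).
  by apply: (cvgM (f := fun j => S c (N (j + n)%N) w - S c n w)); exact: hw'.
move=> j; have nN : (n <= N (j + n))%N by apply: leq_trans (Nge _); exact: leq_addl.
have SE w : S c (N (j + n)%N) w - S c n w = \sum_(n <= k < N (j + n)%N) c k * X k w.
  by rewrite /S (big_cat_nat (leq0n n) nN)//= [LHS]addrC addKr.
under eq_integral do rewrite SE.
apply: le_trans (partial_sum_second_moment _ _ _) _.
by rewrite lee_fin sub// lerD2r.
Qed.

End gaussian_series.

Lemma measurable_aeEqMfun d (T : measurableType d) (R : realType)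
    (mu : {measure set T -> \bar R}) (q : {mfun_ mu, T >-> measurableTypeR R}) :
  measurable_fun setT (q : T -> R).
Proof. exact: (measurable_funPT (repr q)). Qed.

(** The representative chosen in the class of [h] agrees with [h] only almost everywhere, which
    preserves the integral of the square. *)
Lemma Lspace_repr d (T : measurableType d) (R : realType) (mu : probability T R)
    (h : T -> R) : measurable_fun setT h ->
  (\int[mu]_w ((h w) ^+ 2)%:E < +oo)%E ->
  exists g : LspaceType mu (lee1n 2), {ae mu, forall w, g w = h w}.
Proof.
move=> mh h2.
have mh' : @measurable_fun _ _ T (measurableTypeR R) setT h by [].
pose h' : {mfun T >-> measurableTypeR R} :=
  HB.pack h (@isMeasurableFun.Build _ _ T (measurableTypeR R) h mh').
pose q : {mfun_ mu, T >-> measurableTypeR R} := (\pi_({mfun_ mu, T >-> measurableTypeR R}) h')%qT.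
have qh : {ae mu, forall w, q w = h w}.
  have : (repr q == h' %[mod {mfun_ mu, T >-> measurableTypeR R}])%qT by rewrite reprK.
  rewrite eqmodE => /asboolP; apply: filterS => w; exact.
have fin : finite_norm mu 2%:E q.
  rewrite /finite_norm unlock; apply: poweR_lty; apply: le_lt_trans h2.
  have E2 w : (`|(q w)%:E| `^ 2 = ((q w) ^+ 2)%:E)%E.
    by rewrite poweR_EFin powR_mulrn// real_normK// num_real.
  rewrite (eq_integral (fun w => ((q w) ^+ 2)%:E)); last by move=> w _; exact: E2.
  have mq : measurable_fun setT (q : T -> R) by exact: measurable_aeEqMfun.
  rewrite (@ge0_ae_eq_integral _ _ _ mu setT _ (fun w => ((h w) ^+ 2)%:E))//.
  - by apply/measurable_EFinP; exact: measurable_funX.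
  - by apply/measurable_EFinP; exact: measurable_funX.
  - by move=> w _; rewrite lee_fin sqr_ge0.
  - by move=> w _; rewrite lee_fin sqr_ge0.
  - by apply: filterS qh => w qhw _; rewrite qhw.
pose g : LspaceType mu (lee1n 2) :=
  HB.pack q (isFinLebesgue.Build _ _ _ _ _ (lee1n 2) q fin).
exists g; exact: qh.
Qed.

Section isonormal_process.
Context d (T : measurableType d) (R : realType) (mu : probability T R).
Variable X : nat -> T -> R.
Hypothesis mX : forall k, measurable_fun setT (X k).
Hypothesis X_cf : forall n (t : nat -> R) c,
  \int[mu]_w cos (\sum_(0 <= k < n) t k * X k w + c) =
  expR (- ((\sum_(0 <= k < n) t k ^+ 2) / 2)) * cos c.
Variables (E : hilbertType R) (e : nat -> E).
Hypothesis eB : orthonormal_basis e.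

(** The partial sums are exactly linear in the vector, so the defect of linearity of the limits is
    controlled by the tails of Parseval's series and has second moment 0. *)
Lemma isonormal_process_exists : exists hat : E -> LspaceType mu (lee1n 2), [/\
    forall (a : R) (x y : E),
      {ae mu, forall w, hat (a *: x + y) w = a * hat x w + hat y w},
    forall j, {ae mu, forall w, hat (e j) w = X j w} &
    forall t a (x : E), \int[mu]_w cos (t * hat x w + a) =
      expR (- (t ^+ 2 * `|x| ^+ 2 / 2)) * cos a].
Proof.
pose S (x : E) n w : R := \sum_(0 <= k < n) inner x (e k) * X k w.
pose tail (x : E) n : R := `|x| ^+ 2 - \sum_(0 <= k < n) inner x (e k) ^+ 2.
have /choice[h hP] : forall x : E, exists h : T -> R, [/\ measurable_fun setT h,
    forall n, (\int[mu]_w ((h w - S x n w) ^+ 2)%:E <= (tail x n)%:E)%E &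
    forall t a, \int[mu]_w cos (t * h w + a) = expR (- (t ^+ 2 * `|x| ^+ 2 / 2)) * cos a].
  by move=> x; apply: gaussian_series_cvg => //; exact: parseval.
have mh x : measurable_fun setT (h x) by have [] := hP x.
have htail x n : (\int[mu]_w ((h x w - S x n w) ^+ 2)%:E <= (tail x n)%:E)%E by have [] := hP x.
have mS x n : measurable_fun setT (S x n) by exact: measurable_partial_sum.
have mhS x n : measurable_fun setT (fun w => h x w - S x n w) by exact: measurable_funB.
have /choice[hat hatP] : forall x : E, exists g : LspaceType mu (lee1n 2),
    {ae mu, forall w, g w = h x w}.
  move=> x; apply: Lspace_repr => //.
  have := htail x 0%N; rewrite /S/=.
  under eq_integral do rewrite big_geq// subr0.
  by move=> /le_lt_trans; apply; rewrite ltry.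
have tail0 x : tail x n @[n --> \oo] --> (0 : R).
  rewrite -(subrr (`|x| ^+ 2)); apply: cvgB; first exact: cvg_cst.
  exact: parseval.
exists hat; split.
- move=> a x y; set z := a *: x + y.
  have ae0 : {ae mu, forall w, h z w - (a * h x w + h y w) = 0}.
    have mq n : measurable_fun setT (fun w => a * (h x w - S x n w) + (h y w - S y n w)).
      by apply: measurable_funD => //; exact: measurable_funM.
    apply: integral_sqr_eq0.
      by apply: measurable_funB => //; apply: measurable_funD => //; exact: measurable_funM.
    (* From [(p + q)^2 <= 2 p^2 + 2 q^2] used twice, the second time with the factor [a] on [p]. *)
    move=> r r0; pose b n := 2 * tail z n + 2 * (2 * a ^+ 2 * tail x n + 2 * tail y n).
    have b0 : b n @[n --> \oo] --> (0 : R).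
      have -> : 0 = 2 * 0 + 2 * (2 * a ^+ 2 * 0 + 2 * 0) :> R by ring.
      by apply: cvgD; apply: cvgMr => //; apply: cvgD; exact: cvgMr.
    have [n _ /(_ _ (leqnn n)) /= nr] := (cvgrPdist_le _ _).1 b0 _ r0.
    have {nr}nr : b n <= r by rewrite sub0r normrN in nr; exact: le_trans (ler_norm _) nr.
    apply: (@le_trans _ _ (b n)%:E); last by rewrite lee_fin.
    have SE w : S z n w = a * S x n w + S y n w.
      rewrite /S mulr_sumr -big_split/=; apply: eq_bigr => k _.
      by rewrite innerDl innerZl; ring.
    apply: (integral_sqrD (f := fun w => h z w - S z n w)
      (g := fun w => a * (h x w - S x n w) + (h y w - S y n w))) => //.
    + by apply: measurable_funB => //; apply: measurable_funD => //; exact: measurable_funM.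
    + move=> w; rewrite SE; move: (h z w) (h x w) (h y w) (S x n w) (S y n w) => u v1 v2 s1 s2.
      rewrite -subr_ge0 (_ : _ - _ =
        (u - (a * s1 + s2) + (a * (v1 - s1) + (v2 - s2))) ^+ 2) ?sqr_ge0//; ring.
    apply: (integral_sqrD (f := fun w => h x w - S x n w)
      (g := fun w => h y w - S y n w)) => //.
      by rewrite mulr_ge0// sqr_ge0.
    move=> w; move: (h x w - _) (h y w - _) => p q.
    rewrite -subr_ge0 (_ : _ - _ = (a * p - q) ^+ 2) ?sqr_ge0//; ring.
  apply: filterS3 (hatP x) (hatP y) (filterI (hatP z) ae0) => w -> -> [-> +].
  by move/eqP; rewrite subr_eq0 => /eqP.
- move=> j; have ae0 : {ae mu, forall w, h (e j) w - X j w = 0}.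
    apply: integral_sqr_eq0; first exact: measurable_funB.
    (* At [n = j.+1] the partial sum is already [X j] and the tail is 0. *)
    move=> r r0; have := htail (e j) j.+1.
    have -> : tail (e j) j.+1 = 0.
      rewrite /tail normr_innerX eB.1 eqxx big_nat_recr//= big_nat big1; last first.
        by move=> i /andP[_ ij]; rewrite eB.1 gtn_eqF// expr0n.
      by rewrite eB.1 eqxx expr1n add0r subrr.
    have SE w : S (e j) j.+1 w = X j w.
      rewrite /S big_nat_recr//= big_nat big1; last first.
        by move=> i /andP[_ ij]; rewrite eB.1 gtn_eqF// mul0r.
      by rewrite eB.1 eqxx add0r mul1r.
    under eq_integral do rewrite SE.
    by move=> /le_trans; apply; rewrite lee_fin ltW.
  by apply: filterS2 (hatP (e j)) ae0 => w -> /eqP; rewrite subr_eq0 => /eqP.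
- move=> t a x; have [_ _ <-] := hP x.
  have mhat : measurable_fun setT (hat x : T -> R) by exact: measurable_aeEqMfun.
  apply: eq_Rintegral_ae.
  - by apply: bmf_cos; apply: measurable_funD => //; exact: measurable_funM.
  - by apply: bmf_cos; apply: measurable_funD => //; exact: measurable_funM.
  - by apply: filterS (hatP x) => w ->.
Qed.

End isonormal_process.

(** * The space of test functions and its dual *)

Section norms_topology_convergence.
Context (R : realType) (V : lmodType R) (N : nat -> V -> R).
Hypothesis ler_N : forall n x y, N n (x + y) <= N n x + N n y.
Hypothesis N0 : forall n, N n 0 = 0.

(** A subbasic ball around [z] of radius [r] that contains [x] also contains the ball around [x] of
    radius [r - N n (x - z)]. *)
Lemma cvg_norms (F : set_system V) (x : norms_topology N) : Filter F ->
  F --> x <-> forall n r, 0 < r -> F [set y | N n (y - x) < r].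
Proof.
move=> FF; split=> [Fx n r r0|h B /=].
  apply: Fx; rewrite /= nbhsE; exists [set y | N n (y - x) < r] => //.
  split; last by rewrite /= subrr N0.
  exists [set [set y | N n (y - x) < r]]; last first.
    by rewrite predeqE => ?; split=> [[_ ->]|] //; exists [set y | N n (y - x) < r].
  by move=> _ ->; apply: (@finI_from1 _ _ _ id); exists n, x, r.
rewrite (@nbhsE (norms_topology N)).
move=> [_ [[D sD <-] [C DC Cx] sUB]].
rewrite nbhs_filterE; apply: filterS sUB _; apply: (@filterS _ _ _ C).
  by move=> ? ?; exists C.
have /sD [D' sD' IDeC] := DC; rewrite -IDeC; apply: filter_bigI => G DG.
have := Cx; rewrite -IDeC => /(_ _ DG).
have /sD' := DG; rewrite inE => -[n [z [r [r0 ->]]]] /= xr.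
have := h n (r - N n (x - z)); rewrite subr_gt0 => /(_ xr); apply: filterS => y /=.
rewrite ltrBrDr; apply: le_lt_trans.
by rewrite (le_trans _ (ler_N _ _ _))// addrA addrNK.
Qed.

End norms_topology_convergence.

(** * The Hilbert scale of [A] and nuclearity *)

Section scale.
Context (R : realType) (E : hilbertType R) (A : {linear E -> E}).
Context (e : nat -> E) (lambda : nat -> R).
Hypothesis A_sym : forall x y, inner (A x) y = inner x (A y).
Hypothesis A_continuous : continuous A.
Hypothesis eB : orthonormal_basis e.
Hypothesis e_eigen : forall n, A (e n) = lambda n *: e n.
Hypothesis lambda_gt0 : forall n, 0 < lambda n.
Implicit Types (x y : E) (p n : nat).

Let lambda_neq0 n p : lambda n ^+ p != 0.
Proof. by rewrite expf_neq0// gt_eqF. Qed.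

Lemma inner_iter p x n : inner (iter p A x) (e n) = lambda n ^+ p * inner x (e n).
Proof.
elim: p x => [|p IHp] x; first by rewrite expr0 mul1r.
by rewrite iterSr IHp A_sym e_eigen innerZr exprSr mulrA.
Qed.

Lemma iter_inj p x y : iter p A x = iter p A y -> x = y.
Proof.
move=> xy; apply: (basis_inj eB) => n; apply: (mulfI (lambda_neq0 n p)).
by rewrite -!inner_iter xy.
Qed.

Lemma inv_powerK p x : inv_power A p (iter p A x) = x.
Proof.
apply: (@iter_inj p).
exact: (@xgetPex _ 0 [set g | iter p A g = iter p A x] (ex_intro _ x erefl)).
Qed.

Lemma iter_inv_power p x : scale_space A p x -> iter p A (inv_power A p x) = x.
Proof. by move=> [y _ <-]; rewrite inv_powerK. Qed.

(** One direction is Bessel's inequality for the preimage; in the other, Riesz-Fischer builds a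
    preimage from the coordinates it must have. *)
Lemma scale_spaceE p : scale_space A p =
  [set x | (\sum_(0 <= n <oo)
     (lambda n ^- (2 * p) * inner x (e n) ^+ 2)%:E < +oo)%E].
Proof.
have cE x n : lambda n ^- (2 * p) * inner x (e n) ^+ 2 =
    (lambda n ^- p * inner x (e n)) ^+ 2.
  by rewrite exprMn exprVn -exprM mulnC.
apply/seteqP; split=> x /=.
  move=> [y _ <-]; apply/nneseries_ltyP => [n|].
    by rewrite cE sqr_ge0.
  exists (`|y| ^+ 2) => n; rewrite (le_trans _ (bessel eB n y))//.
  apply: ler_sum => k _; rewrite cE inner_iter mulKf //.
have u0 n : 0 <= lambda n ^- (2 * p) * inner x (e n) ^+ 2 by rewrite cE sqr_ge0.
move=> /(nneseries_ltyP u0)[M xM].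
have [|y yE] := @riesz_fischer _ _ _ eB (fun n => lambda n ^- p * inner x (e n)) M.
  move=> n; rewrite (le_trans _ (xM n))//.
  by apply: ler_sum => k _; rewrite cE.
exists y => //; apply: (basis_inj eB) => n.
by rewrite inner_iter yE mulVKf.
Qed.

Local Notation V := (test_space A).
Implicit Types u v w : V.

Lemma test_scale_space p v : scale_space A p v.
Proof. by have := test_valP v; rewrite inE => /(_ p I). Qed.

(** This is [A^-p v], an isometry from [|.|_p] to the norm of [E]: the space [E] itself thus serves
    as the completion for every [p], with [coord p] as embedding. *)
Definition coord p v : E := inv_power A p v.

Lemma iter_coord p v : iter p A (coord p v) = test_val v.
Proof. exact/iter_inv_power/test_scale_space. Qed.

Lemma coord_uniq p v x : iter p A x = test_val v -> coord p v = x.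
Proof. by rewrite /coord => <-; rewrite inv_powerK. Qed.

Lemma iterP p (a : R) x y : iter p A (a *: x + y) = a *: iter p A x + iter p A y.
Proof. by elim: p => //= p ->; rewrite linearP. Qed.

Fact coord_linear p : linear (coord p).
Proof. by move=> a u v; apply: coord_uniq; rewrite iterP !iter_coord. Qed.

HB.instance Definition _ p := GRing.isLinear.Build R V E _ (coord p) (coord_linear p).

Lemma coordS p v : A (coord p.+1 v) = coord p v.
Proof. by symmetry; apply: coord_uniq; rewrite -iterSr iter_coord. Qed.

Lemma inner_coord p v n : inner (coord p v) (e n) = lambda n ^- p * inner (test_val v) (e n).
Proof. by rewrite -[in RHS](iter_coord p v) inner_iter mulKf. Qed.

Lemma scale_normE p v : scale_norm A p v = `|coord p v|.
Proof. by []. Qed.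

Lemma test_eqP u v : test_val u = test_val v -> u = v.
Proof. exact: val_inj. Qed.

Lemma cvg_test (F : set_system V) (x : V) : Filter F ->
  F --> x <-> forall p r, 0 < r -> F [set y | `|coord p (y - x)| < r].
Proof.
move=> FF; apply: (@cvg_norms R V (fun p v => scale_norm A p v)) => [p u v|p].
  by rewrite !scale_normE linearD ler_normD.
by rewrite scale_normE linear0 normr0.
Qed.

Lemma nbhs_test p (x : V) r : 0 < r -> nbhs x [set y | `|coord p (y - x)| < r].
Proof.
have FF : Filter (nbhs x) := @nbhs_filter V x.
by apply: (cvg_test x FF).1; exact: cvg_id.
Qed.

Lemma cvg_coord p (x : V) : coord p v @[v --> x] --> coord p x.
Proof.
have FF : Filter (nbhs x) := @nbhs_filter V x.
apply/(@cvgrPdist_lt _ _ _ (nbhs x)) => r r0.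
apply: (@filterS _ _ FF _ _ _ (nbhs_test p x r0)) => v /=.
by rewrite linearB distrC.
Qed.

Lemma A_bound : exists2 K, 1 <= K & forall x, `|A x| <= K * `|x|.
Proof.
have [k k0 Ak] := @linear_lipschitz R E E A A_continuous.
exists (k + 1); first by rewrite lerDr ltW.
by move=> x; rewrite (le_trans (Ak x))// ler_wpM2r// lerDl.
Qed.

(** [A] need not be a contraction, so the norms increase only up to a constant. *)
Lemma coord_le n m : (n <= m)%N ->
  exists2 K, 0 < K & forall v, `|coord n v| <= K * `|coord m v|.
Proof.
have [K K1 AK] := A_bound.
have K0 : 0 < K by exact: lt_le_trans K1.
move=> /subnKC <-; elim: (m - n)%N => [|d [L L0 IHd]].
  by exists 1 => // v; rewrite addn0 mul1r.
exists (L * K); first exact: mulr_gt0.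
move=> v; rewrite (le_trans (IHd v))// -mulrA ler_wpM2l ?(ltW L0)//.
by rewrite addnS -coordS.
Qed.

(** The norms being comparable, balls of single norms around 0 form a filter base. Their filter
    converges to 0, so every neighbourhood contains such a ball. *)
Lemma nbhs_test0 (U : set V) : nbhs (0 : V) U ->
  exists p r, 0 < r /\ forall v, `|coord p v| < r -> U v.
Proof.
pose B (i : nat * R) := [set v : V | `|coord i.1 v| < i.2].
pose F := filter_from [set i : nat * R | 0 < i.2] B.
have FF : Filter F.
  apply: filter_from_filter; first by exists (0%N, 1) => /=.
  move=> [n r] [m s] /= r0 s0.
  have [K K0 nK] := coord_le (leq_maxl n m).
  have [L L0 mL] := coord_le (leq_maxr n m).
  exists (maxn n m, Num.min (r / K) (s / L)) => /=; first by rewrite lt_min !divr_gt0.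
  move=> v /=; rewrite /B/= lt_min !ltr_pdivlMr// => /andP[vK vL].
  by split; [rewrite (le_lt_trans (nK v))// mulrC|rewrite (le_lt_trans (mL v))// mulrC].
have F0 : F --> (0 : V).
  apply/cvg_test => p r r0; exists (p, r) => // v.
  by rewrite /B/= subr0.
move=> /F0 [[p r] /= r0 BU]; exists p, r; split=> // v vr; exact: BU.
Qed.

Lemma test_add_continuous : continuous (fun x : V * V => x.1 + x.2).
Proof.
move=> [x y]; apply/cvg_test => p r r0.
have r2 : 0 < r / 2 by rewrite divr_gt0.
have hx := nbhs_test p x r2.
have hy := nbhs_test p y r2.
exists ([set z | `|coord p (z - x)| < r / 2], [set z | `|coord p (z - y)| < r / 2]) => //=.
move=> [u v] [/= ux vy]; rewrite opprD addrACA linearD.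
by rewrite (le_lt_trans (ler_normD _ _))// (splitr r) ltrD.
Qed.

Lemma test_scale_continuous : continuous (fun z : R^o * V => z.1 *: z.2).
Proof.
move=> [a x]; apply/cvg_test => p r r0.
(* In [b y - a x = b (y - x) + (b - a) x], a radius [d <= 1] gives [|b| <= |a| + 1], and the whole
   is bounded by [d M]. *)
pose M := `|a| + 1 + `|coord p x|.
have M0 : 0 < M by rewrite ltr_wpDr// ltr_wpDl.
pose d := Num.min 1 (r / 2 / M).
have d0 : 0 < d by rewrite lt_min ltr01 !divr_gt0.
have hx := nbhs_test p x d0.
exists (ball (a : R^o) d, [set z | `|coord p (z - x)| < d]) => /=.
  by split=> //; exact: nbhsx_ballx.
move=> [b y] [/=]; rewrite -ball_normE/= => ab yx.
have -> : b *: y - a *: x = b *: (y - x) + (b - a) *: x.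
  by rewrite scalerBr scalerBl addrA addrNK.
rewrite linearD !linearZ (le_lt_trans (ler_normD _ _))// !normrZ.
have d1 : d <= 1 by rewrite ge_min lexx.
have b1 : `|b| <= `|a| + 1.
  rewrite -(subrK a b) addrC (le_trans (ler_normD _ _))// lerD2l.
  by rewrite distrC ltW// (lt_le_trans ab).
have dr : d * M <= r / 2 by rewrite -ler_pdivlMr// ge_min lexx orbT.
apply: (@le_lt_trans _ _ (d * M)); last by rewrite (le_lt_trans dr)// gtr_pMr// invf_lt1// ltr1n.
rewrite /M mulrDr lerD//.
  by rewrite mulrC; apply: ler_pM => //; exact: ltW.
by rewrite ler_wpM2r// distrC ltW.
Qed.

(** The images of a Cauchy filter by [coord p] converge in [E] to some [y p]. Continuity of [A]
    gives [A (y p.+1) = y p], so [y 0] lies in the range of every power of [A] and is the limit. *)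
Lemma test_complete : vector_complete (test_space A).
Proof.
move=> F FF cF.
have cp p : cvg (coord p v @[v --> F]).
  apply/cauchy_cvgP/cauchy_exP => r r0.
  have [|B FB Br] := cF [set v | `|coord p v| < r].
    apply: (@filterS _ _ (@nbhs_filter V 0) _ _ _ (nbhs_test p 0 r0)) => v.
    by rewrite /= subr0.
  have [b Bb] := filter_ex FB.
  exists (coord p b); change (F [set v | ball (coord p b) r (coord p v)]).
  apply: filterS FB => v Bv /=.
  by rewrite -ball_normE/= -linearB; exact: Br.
pose y p := lim (coord p v @[v --> F]).
have yP p : coord p v @[v --> F] --> y p := cp p.
have yS p : A (y p.+1) = y p.
  have h : A (coord p.+1 v) @[v --> F] --> A (y p.+1).
    exact: (@cvg_comp _ _ _ (coord p.+1) A _ _ _ (yP p.+1) (@A_continuous (y p.+1))).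
  have {}h : coord p v @[v --> F] --> A (y p.+1).
    by under eq_fun do rewrite -coordS.
  exact: (cvg_unique _ h (yP p)).
have yi p : iter p A (y p) = y 0%N.
  by elim: p => //= p IHp; rewrite -iterS iterSr yS.
have y0 : y 0%N \in test_pred A.
  by rewrite inE => p _; exists (y p).
exists (TestSpace y0); apply/cvg_test => p r r0.
have cy : coord p (TestSpace y0) = y p by exact: coord_uniq.
move/cvgrPdist_lt : (yP p) => /(_ r r0); apply: filterS => v /=.
have -> : coord p (v - TestSpace y0) = coord p v - y p by rewrite -cy; exact: linearB.
by rewrite distrC.
Qed.

Definition coord_inner p u v : R := inner (coord p u) (coord p v).

Fact coord_inner_bilinear p :
  bilinear_for (@GRing.mul R : GRing.Scale.law R R)
    ((idfun \; @GRing.mul R) : GRing.Scale.law R R) (coord_inner p).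
Proof.
split=> [w a u v|w a u v]; rewrite /coord_inner linearP.
  by rewrite innerDl innerZl.
by rewrite innerDr innerZr.
Qed.

HB.instance Definition _ p :=
  bilinear_isBilinear.Build R V V R _ _ (coord_inner p) (coord_inner_bilinear p).

Fact coord_inner_hermitian p u v :
  coord_inner p u v = (-1) ^+ false * idfun (coord_inner p v u).
Proof. by rewrite expr0 mul1r /coord_inner inner_sym. Qed.

HB.instance Definition _ p :=
  isHermitianSesquilinear.Build R V false idfun (coord_inner p) (coord_inner_hermitian p).

Fact coord_inner_gt0 p u : u != 0 -> 0 < coord_inner p u u.
Proof.
move=> u0; rewrite /coord_inner -normr_innerX exprn_gt0// normr_gt0.
apply: contra_neq u0 => cu; apply: test_eqP.
by rewrite -(iter_coord p u) cu -[in LHS](linear0 (coord p)) iter_coord.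
Qed.

HB.instance Definition _ p :=
  isDotProduct.Build R V (coord_inner p) (coord_inner_gt0 p).

Lemma sqrt_coord_inner p v : Num.sqrt (coord_inner p v v) = scale_norm A p v.
Proof. by rewrite /coord_inner -normr_inner. Qed.

Lemma basis_in_test p n : iter p A (lambda n ^- p *: e n) = e n.
Proof.
apply: (basis_inj eB) => k; rewrite inner_iter innerZl eB.1.
by case: eqP => [->|]; rewrite ?mulr1 ?mulr0// mulfV.
Qed.

Fact test_basis_subproof n : e n \in test_pred A.
Proof. by rewrite inE => p _; exists (lambda n ^- p *: e n) => //; exact: basis_in_test. Qed.

Definition test_basis n : V := TestSpace (test_basis_subproof n).

Lemma coord_test_basis p n : coord p (test_basis n) = lambda n ^- p *: e n.
Proof. by apply: coord_uniq; exact: basis_in_test. Qed.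

Lemma dense_coord p : dense (range (coord p)).
Proof.
move=> O O0 oO; have [x [Ox [s [c xE]]]] := eB.2 O O0 oO.
exists x; split=> //.
(* The factor [lambda i ^+ p] cancels the one that [coord p] puts on the basis vectors. *)
exists (\sum_(i <- s) (c i * lambda i ^+ p) *: test_basis i) => //.
rewrite xE linear_sum; apply: eq_bigr => i _.
by rewrite linearZ/= [coord p _]coord_test_basis scalerA mulfK.
Qed.

Lemma test_nuclear : hilbert_schmidt A -> nuclear_space (test_space A).
Proof.
move=> A_HS; split.
- exact: test_add_continuous.
- exact: test_scale_continuous.
- exact: test_complete.
- exists (fun p => coord_inner p : {dot V for idfun}); split.
    have -> // : (fun n (x : V) => Num.sqrt (coord_inner n x x)) = (fun p (f : V) => scale_norm A p f).
    by apply/funext => n; apply/funext => v; exact: sqrt_coord_inner.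
  exists (fun=> E), (fun p => coord p : {linear V -> E}); split=> [p|p].
    by split=> //; exact: dense_coord.
  exists p.+1 => //; exists A => // v; exact: coordS.
Qed.

(** * Continuous functionals and the Borel sets of the dual *)

Local Notation D := (dual V).
Implicit Types f g : D.

Definition basis_sum n v : V := \sum_(0 <= k < n) inner (test_val v) (e k) *: test_basis k.

Lemma coord_basis_sum p n v :
  coord p (basis_sum n v) = \sum_(0 <= k < n) inner (coord p v) (e k) *: e k.
Proof.
rewrite /basis_sum linear_sum; apply: eq_bigr => k _.
by rewrite linearZ/= [coord p _]coord_test_basis inner_coord scalerA mulrC.
Qed.

Lemma near_basis_sum p v (r : R) : 0 < r ->
  \forall n \near \oo, `|coord p (basis_sum n v - v)| < r.
Proof.
move=> r0; have /cvgrPdist_lt/(_ r r0) := @cvg_basis _ _ _ eB (coord p v).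
by apply: filterS => n; rewrite /= linearB -coord_basis_sum distrC.
Qed.

Lemma cvg_basis_sum v : basis_sum n v @[n --> \oo] --> v.
Proof. by apply/cvg_test => p r r0; exact: near_basis_sum. Qed.

Lemma functional_sum f n (c : nat -> R) :
  f (\sum_(0 <= k < n) c k *: test_basis k) = \sum_(0 <= k < n) c k * f (test_basis k).
Proof. by rewrite linear_sum; apply: eq_bigr => k _; rewrite linearZ. Qed.

Lemma cvg_functional f v :
  \sum_(0 <= k < n) inner (test_val v) (e k) * f (test_basis k) @[n --> \oo] --> (f v : R).
Proof.
under eq_fun do rewrite -functional_sum.
exact: (@cvg_comp _ _ _ (fun n => basis_sum n v) f _ _ _ (@cvg_basis_sum v)
  (@dual_continuous _ _ f v)).
Qed.

Lemma functional_bound f : exists p C, 0 < C /\ forall v, `|f v| <= C * `|coord p v|.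
Proof.
have fc : f v @[v --> (0 : V)] --> (f 0 : R^o) := @dual_continuous _ _ f 0.
have [p [r [r0 fr]]] : exists p r, 0 < r /\ forall v, `|coord p v| < r -> `|f v| < 1.
  apply: nbhs_test0; apply: (fc [set y : R^o | `|y| < 1]).
  rewrite linear0.
  have := nbhsx_ballx (0 : R^o) 1 ltr01; rewrite -ball_normE.
  by congr (nbhs _ _); apply/seteqP; split=> y /=; rewrite sub0r normrN.
exists p, (2 / r); split; first by rewrite divr_gt0.
move=> v; have [->|v0] := eqVneq v 0; first by rewrite !linear0 normr0 normr0 mulr0.
have cv0 : 0 < `|coord p v|.
  rewrite normr_gt0; apply: contra_neq v0 => cv; apply: test_eqP.
  by rewrite -(iter_coord p v) cv -[in LHS](linear0 (coord p)) iter_coord.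
pose a := r / 2 / `|coord p v|.
have a0 : 0 < a by rewrite !divr_gt0.
have ca : `|coord p (a *: v)| < r.
  have -> : coord p (a *: v) = a *: coord p v by exact: linearZ.
  by rewrite normrZ (gtr0_norm a0) /a divfK ?gt_eqF// gtr_pMr// invf_lt1// ltr1n.
have := fr _ ca; rewrite linearZ normrZ (gtr0_norm a0) -ltr_pdivlMl// mulr1.
suff -> : 2 / r * `|coord p v| = a^-1 by move=> /ltW.
by rewrite /a !invf_div mulrC.
Qed.

Lemma cauchy_schwarz_sum (I : Type) (s : seq I) (P : pred I) (a b : I -> R) :
  (\sum_(i <- s | P i) a i * b i) ^+ 2 <=
  (\sum_(i <- s | P i) a i ^+ 2) * (\sum_(i <- s | P i) b i ^+ 2).
Proof.
pose X := \sum_(i <- s | P i) a i ^+ 2; pose Y := \sum_(i <- s | P i) b i ^+ 2.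
pose Z := \sum_(i <- s | P i) a i * b i.
have h (u w : R) : 0 <= u ^+ 2 * X + 2 * u * w * Z + w ^+ 2 * Y.
  rewrite /X /Y /Z !mulr_sumr -!big_split/=; apply: sumr_ge0 => i _.
  by have := sqr_ge0 (u * a i + w * b i); congr (0 <= _); ring.
have X0 : 0 <= X by apply: sumr_ge0 => i _; exact: sqr_ge0.
have Y0 : 0 <= Y by apply: sumr_ge0 => i _; exact: sqr_ge0.
rewrite -/X -/Y -/Z.
have [Y00|Yn0] := eqVneq Y 0.
  have [->|Zn0] := eqVneq Z 0; first by rewrite expr0n mulr_ge0.
  (* For [Y = 0] the form is affine in [w]; this [w] would give it the value -1. *)
  have := h 1 (- (X + 1) / (2 * Z)); rewrite Y00 mulr0 addr0 expr1n mul1r.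
  have -> : 2 * 1 * (- (X + 1) / (2 * Z)) * Z = - (X + 1) by field.
  lra.
have {}Y0 : 0 < Y by rewrite lt_neqAle eq_sym Yn0.
have := h Y (- Z).
have -> : Y ^+ 2 * X + 2 * Y * - Z * Z + (- Z) ^+ 2 * Y = Y * (X * Y - Z ^+ 2) by ring.
by rewrite pmulr_rge0// subr_ge0.
Qed.

(* The polar of a ball of [scale_norm p], described on the basis. *)
Definition polar p (N : nat) : set D :=
  [set f | forall n, \sum_(0 <= k < n) (lambda k ^+ p * f (test_basis k)) ^+ 2 <= N%:R].

(** Cauchy-Schwarz after moving [lambda k ^+ p] from the coordinates of [v], which become those of
    [coord p v], to the values of [f]. *)
Lemma polar_bound p N f v : polar p N f -> `|f v| ^+ 2 <= N%:R * `|coord p v| ^+ 2.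
Proof.
move=> fN.
have h : (\sum_(0 <= k < n) inner (test_val v) (e k) * f (test_basis k)) ^+ 2 @[n --> \oo]
    --> `|f v| ^+ 2.
  have -> : `|f v| ^+ 2 = (f v : R) * (f v : R) := real_normK (num_real (f v : R)).
  exact: cvgM (@cvg_functional f v) (@cvg_functional f v).
rewrite -(cvg_lim _ h)//; apply: limr_le; first exact: cvgP h.
apply: nearW => n.
have e1 : \sum_(0 <= k < n) inner (test_val v) (e k) * f (test_basis k) =
    \sum_(0 <= k < n) (lambda k ^+ p * f (test_basis k)) * inner (coord p v) (e k).
  apply: eq_bigr => k _; rewrite inner_coord; field; exact: lambda_neq0.
rewrite e1 (le_trans (cauchy_schwarz_sum _ _ _ _))//.
apply: ler_pM; [apply: sumr_ge0 => k _; exact: sqr_ge0|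
  apply: sumr_ge0 => k _; exact: sqr_ge0|exact: fN|exact: bessel].
Qed.

Lemma functional_in_polar f : exists p N, polar p N f.
Proof.
have [p [C [C0 fC]]] := functional_bound f.
exists p, (Num.trunc (C ^+ 2)).+1 => n.
set S := \sum_(0 <= k < n) _.
have S0 : 0 <= S by apply: sumr_ge0 => k _; exact: sqr_ge0.
(* The extremal vector of Cauchy-Schwarz: both [f w] and [|w|_p^2] equal [S], so the bound on [f]
   reads [S <= C sqrt S]. *)
pose c k := lambda k ^+ p * (lambda k ^+ p * f (test_basis k)).
pose w : V := \sum_(0 <= k < n) c k *: test_basis k.
have fw : f w = S.
  by rewrite /w functional_sum; apply: eq_bigr => k _; rewrite /c expr2 -!mulrA;
    congr (_ * _); exact: mulrCA.
have cw : `|coord p w| ^+ 2 = S.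
  rewrite linear_sum.
  under eq_bigr do rewrite linearZ/= [coord p _]coord_test_basis scalerA /c mulrC mulKf//.
  by rewrite (normr_sum_basis eB).
have := fC w; rewrite fw (ger0_norm S0) => h.
have SS : S ^+ 2 <= C ^+ 2 * S.
  by rewrite -cw -exprMn ler_pXn2r ?nnegrE ?cw// mulr_ge0// ltW.
apply/ltW/(le_lt_trans _ (truncnS_gt (C ^+ 2))).
have [->|Sn0] := eqVneq S 0; first exact: sqr_ge0.
by rewrite -(@ler_pM2r _ S) ?lt_neqAle ?S0 ?[0 == _]eq_sym ?Sn0// -expr2.
Qed.

Definition coord_gen : set (set D) :=
  [set B | exists k a, B = [set f : D | a < (f (test_basis k) : R)]].

Local Notation cylinder := (g_sigma_algebraType coord_gen).

Lemma measurable_eval_gen k :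
  measurable_fun [set: cylinder] (fun f : D => f (test_basis k) : R).
Proof.
by apply: measurable_fun_gt => a; apply: sub_sigma_algebra; exists k, a.
Qed.

Lemma measurable_polar p N : @measurable _ cylinder (polar p N).
Proof.
rewrite (_ : polar p N = \bigcap_n [set f : D |
  \sum_(0 <= k < n) (lambda k ^+ p * f (test_basis k)) ^+ 2 <= N%:R]); last first.
  by apply/seteqP; split=> f /= fN n; [move=> _|]; exact: fN.
apply: bigcapT_measurable => n.
have m : measurable_fun [set: cylinder] (fun f : D =>
    \sum_(0 <= k < n) (lambda k ^+ p * f (test_basis k)) ^+ 2 : R).
  apply: measurable_sum => k; apply: measurable_funX; apply: measurable_funM => //.
  exact: measurable_eval_gen.
have := m measurableT `]-oo, N%:R]%classic (measurable_itv _).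
by rewrite setTI; congr (measurable _).
Qed.

(** Only finitely many coordinates are constrained, with rational endpoints, so there are countably
    many boxes. *)
Definition box (s : seq (rat * rat)) : set D := [set f | forall k, (k < size s)%N ->
  ratr (nth (0, 0) s k).1 < (f (test_basis k) : R) < ratr (nth (0, 0) s k).2].

Lemma measurable_box s : @measurable _ cylinder (box s).
Proof.
rewrite (_ : box s = \bigcap_(k in [set k | (k < size s)%N])
  ((fun f : D => f (test_basis k) : R) @^-1`
     `](ratr (nth (0, 0) s k).1 : R), (ratr (nth (0, 0) s k).2 : R)[%classic)); last first.
  apply/seteqP; split=> f /= fs k ks; have := fs k ks; rewrite /= in_itv//.
apply: bigcap_measurableType => k _; rewrite -[X in measurable X]setTI.
exact: (@measurable_eval_gen k).
Qed.

(** The filter of coordinate neighbourhoods of [f] within the polar converges weakly to [f]: each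
    [v] is approximated by its partial sums, with an error uniform over the polar by
    equicontinuity. *)
Lemma polar_near p N f (U : set D) : polar p N f -> open U -> U f ->
  exists n r, 0 < r /\ forall g, polar p N g ->
    (forall k, (k < n)%N -> `|g (test_basis k) - f (test_basis k)| < r) -> U g.
Proof.
move=> fN oU Uf.
(* The factor [N + 1] dominates the square root of [N] and stays positive for [N = 0]. *)
have gN g v : polar p N g -> `|g v| <= (N%:R + 1) * `|coord p v|.
  move=> /(polar_bound v) h; rewrite -(@ler_pXn2r _ 2)// ?nnegrE ?mulr_ge0 ?addr_ge0//.
  rewrite (le_trans h)// exprMn ler_wpM2r ?sqr_ge0//.
  by have := ler0n R N; move: (N%:R : R) => t t0; rewrite expr2; nra.
pose B (i : nat * R) := [set g : D | polar p N g /\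
  forall k, (k < i.1)%N -> `|g (test_basis k) - f (test_basis k)| < i.2].
pose F := filter_from [set i : nat * R | 0 < i.2] B.
have FF : Filter F.
  apply: filter_from_filter; first by exists (0%N, 1) => /=.
  move=> [n r] [m s] /= r0 s0; exists (maxn n m, Num.min r s) => /=.
    by rewrite lt_min r0.
  move=> g [/= gK gr]; split; split=> // k kn; have := gr k; rewrite lt_min leq_max kn ?orbT.
    by move=> /(_ isT)/andP[].
  by move=> /(_ isT)/andP[].
have Ff : F --> f.
  apply/cvg_sup => v W; rewrite nbhsE => -[_ [[G oG <-] /= Gf] sW].
  have : (fun g : D => (g v : R)) @ F --> (f v : R).
    apply/cvgrPdist_lt => r r0.
    (* The margin [r] is shared out as [r / 4] for the remainder of [v] under [f], the same under
       [g], and [r / 2] for the values at the partial sum. *)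
    have c0 : 0 < r / 4 / (N%:R + 1) by rewrite !divr_gt0// ltr_wpDl.
    have near_vn : \forall n \near \oo,
        `|coord p (basis_sum n v - v)| < r / 4 / (N%:R + 1).
      exact: near_basis_sum.
    have [n vn] := filter_ex near_vn.
    pose M := \sum_(0 <= k < n) `|inner (test_val v) (e k)|.
    have M0 : 0 <= M by apply: sumr_ge0.
    exists (n, r / 2 / (M + 1)); first by rewrite /= !divr_gt0// ltr_wpDl.
    move=> g [gK /= gf].
    have bd h : polar p N h -> `|h (v - basis_sum n v)| < r / 4.
      move=> hN; rewrite (le_lt_trans (gN _ _ hN))// mulrC -ltr_pdivlMr ?ltr_wpDl//.
      by rewrite linearB -normrN opprB -linearB.
    have sm : `|g (basis_sum n v) - f (basis_sum n v)| <= r / 2.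
      rewrite !functional_sum -sumrB (le_trans (ler_norm_sum _ _ _))//.
      apply: (@le_trans _ _ (\sum_(0 <= k < n) `|inner (test_val v) (e k)| * (r / 2 / (M + 1)))).
        rewrite big_nat [leRHS]big_nat; apply: ler_sum => k /= kn.
        by rewrite -mulrBr normrM ler_wpM2l// ltW// gf.
      rewrite -mulr_suml -/M mulrCA ler_piMr ?divr_ge0 ?ltW//.
      by rewrite ltr_pdivrMr ?ltr_wpDl// mul1r ltrDl.
    rewrite (_ : (f v : R) - g v = f (v - basis_sum n v) - g (v - basis_sum n v)
      - (g (basis_sum n v) - f (basis_sum n v))); last first.
      have fB (h : D) : h (v - basis_sum n v) = (h v : R) - h (basis_sum n v) :> R.
        exact: linearB.
      by rewrite !fB; move: (f v : R) (g v : R) (f _ : R) (g _ : R) => a b c d; ring.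
    rewrite (le_lt_trans (ler_normB _ _))//.
    rewrite (_ : r = (r / 4 + r / 4) + r / 2); last by field.
    rewrite ltr_leD// (le_lt_trans (ler_normB _ _))//.
    by rewrite ltrD//; exact: bd.
  have nG : nbhs (f v : R^o) G by rewrite nbhsE; exists G.
  by move=> /(_ G nG) FG; apply: (@filterS _ F FF _ _ sW); exact: FG.
have [|[n r] /= r0 BU] := Ff U; first by rewrite nbhsE; exists U.
by exists n, r; split=> // g gN' gr; apply: BU.
Qed.

Lemma box_exists n (x : nat -> R) (r : R) : 0 < r -> exists s : seq (rat * rat),
  size s = n /\ forall k, (k < n)%N ->
    x k - r < ratr (nth (0, 0) s k).1 < x k /\ x k < ratr (nth (0, 0) s k).2 < x k + r.
Proof.
move=> r0.
have q k : exists q : rat * rat, x k - r < ratr q.1 < x k /\ x k < ratr q.2 < x k + r.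
  have [a] := @rat_in_itvoo R (x k - r) (x k) ltac:(lra).
  have [b] := @rat_in_itvoo R (x k) (x k + r) ltac:(lra).
  by rewrite !in_itv/= => ? ?; exists (a, b).
exists (mkseq (fun k => xget (0, 0) [set q : rat * rat | x k - r < ratr q.1 < x k /\ x k < ratr q.2 < x k + r]) n).
rewrite size_mkseq; split=> // k kn; rewrite nth_mkseq//.
exact: (xgetPex (0, 0) (q k)).
Qed.

(** An open set is the union of those intersections of a box and a polar that it contains; the
    triples [(p, N, s)] indexing them are countable. *)
Lemma open_cylinder (U : set D) : open U -> @measurable _ cylinder U.
Proof.
move=> oU.
have dist_lt (a b c d t : R) : a - t < c -> d < a + t -> c < b -> b < d -> `|b - a| < t.
  by move=> *; rewrite ltr_distl; apply/andP; split; lra.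
pose B (i : nat * nat * seq (rat * rat)) := box i.2 `&` polar i.1.1 i.1.2.
pose C i := if `[< B i `<=` U >] then B i else set0.
have -> : U = \bigcup_i C i.
  apply/seteqP; split=> f; last first.
    by move=> [i _]; rewrite /C; case: asboolP => // BU /BU.
  move=> Uf; have [p [N fN]] := functional_in_polar f.
  have [n [r [r0 nrU]]] := polar_near fN oU Uf.
  have [s [sn sr]] := box_exists n (fun k => f (test_basis k) : R) r0.
  exists (p, N, s) => //; rewrite /C; case: asboolP => [_|].
    split=> // k ks; rewrite sn in ks.
    by have [/andP[_ ->] /andP[-> _]] := sr k ks.
  case=> g [gs gN]; apply: nrU => // k kn.
  have [/andP[h1 h2] /andP[h3 h4]] := sr k kn.
  have := gs k; rewrite sn => /(_ kn)/andP[h5 h6].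
  exact: dist_lt h1 h4 h5 h6.
apply: countable_bigcupT_measurable => [|i]; first exact: countableP.
rewrite /C; case: asboolP => _; last exact: measurable0.
by apply: measurableI; [exact: measurable_box|exact: measurable_polar].
Qed.

Lemma eval_continuous v : continuous (fun f : D => f v : R^o).
Proof.
move=> f W Wf.
have FF : Filter (nbhs f) := @nbhs_filter D f.
apply: ((cvg_sup _ f FF).1 (@cvg_id _ (nbhs f)) v).
exact: initial_continuous.
Qed.

Lemma dual_borelE : @measurable _ (dual_borel V) = <<s coord_gen >>.
Proof.
apply/seteqP; split.
  apply: smallest_sub; first exact: smallest_sigma_algebra.
  exact: open_cylinder.
apply: smallest_sub; first exact: smallest_sigma_algebra.
move=> _ [k [a ->]]; apply: sub_sigma_algebra.
rewrite -[X in open X]/((fun f : D => f (test_basis k) : R^o) @^-1` [set y : R | a < y]).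
apply: open_comp; last exact: open_gt.
by move=> f _; exact: eval_continuous.
Qed.

(** * The white noise measure *)

Local Notation dualB := (dual_borel V).

Definition eval_basis k (f : dualB) : R := f (test_basis k).

Lemma measurable_into_dual d (T : measurableType d) (F : T -> dualB) :
  (forall k, measurable_fun setT (fun s => eval_basis k (F s))) ->
  measurable_fun setT F.
Proof.
move=> mF; apply: (@measurability _ _ T dualB setT F coord_gen); first exact: dual_borelE.
move=> _ [_ [k [a ->]] <-].
have := mF k measurableT `]a, +oo[%classic (measurable_itv _).
by congr (measurable _); congr (_ `&` _); apply/seteqP; split => s /=; rewrite in_itv/= andbT.
Qed.

Lemma measurable_eval_basis k :
  measurable_fun setT (eval_basis k).
Proof.
apply: measurable_fun_gt => a; rewrite dual_borelE.
by apply: sub_sigma_algebra; exists k, a.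
Qed.

(** With [y] in [E] of coordinates [lambda k * c k], the functional is [v |-> <A^-1 v, y>]; since
    [A^-1 e_k = lambda_k^-1 e_k], its value at [e_k] is [c k]. *)
Lemma functional_of_coordinates (c : nat -> R) :
  (\sum_(0 <= k <oo) ((lambda k * c k) ^+ 2)%:E < +oo)%E ->
  exists f : dualB, forall k, eval_basis k f = c k.
Proof.
move=> /nneseries_ltyP -/(_ (fun k => sqr_ge0 _)) [M cM].
have [y yE] := riesz_fischer eB cM.
pose F (v : V) : R^o := inner (coord 1 v) y.
have linF : linear F.
  by move=> a u v; rewrite /F linearP innerDl innerZl.
pose f : {linear V -> R^o} := HB.pack F (GRing.isLinear.Build R V R^o _ F linF).
have cf : continuous f.
  move=> v; have FF : Filter (nbhs v) := @nbhs_filter V v.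
  have h : inner (coord 1 u) y @[u --> (v : V)] --> inner (coord 1 v) y.
    by apply: cvg_inner; exact: cvg_coord.
  exact: h.
exists (Dual cf) => k; rewrite /eval_basis/= /F.
by rewrite coord_test_basis innerZl inner_sym yE expr1 mulKf// gt_eqF.
Qed.

Lemma gaussian_measure_exists :
  (\sum_(0 <= n <oo) (lambda n ^+ 2)%:E < +oo)%E ->
  exists mu : probability dualB R, forall n (t : nat -> R) c,
  \int[mu]_s cos (\sum_(0 <= k < n) t k * eval_basis k s + c) =
  expR (- ((\sum_(0 <= k < n) t k ^+ 2) / 2)) * cos c.
Proof.
move=> lambda_sum.
have mxi k : measurable_fun [set: measurableTypeR R] (@gauss_seq R k : measurableTypeR R -> R).
  exact: measurable_gauss_seq.
have xi_cf n (t : nat -> R) c :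
    \int[unif R]_s cos (\sum_(0 <= k < n) t k * gauss_seq k s + c) =
    expR (- ((\sum_(0 <= k < n) t k ^+ 2) / 2)) * cos c.
  rewrite big_mkord -gauss_seq_cf; congr (Rintegral _ _ _); apply/funext => s.
  by rewrite big_mkord.
pose u k (s : measurableTypeR R) : R := (lambda k * gauss_seq k s) ^+ 2.
have mu_ k : measurable_fun setT (u k).
  by apply: measurable_funX; apply: measurable_funM.
have u0 k s : 0 <= u k s by exact: sqr_ge0.
pose G := [set s | (\sum_(0 <= k <oo) (u k s)%:E < +oo)%E].
have mG : measurable G by exact: measurable_summable.
have aeG : {ae unif R, forall s, G s}.
  apply: ae_summable lambda_sum => // k.
  (* The block from [k] to [k.+1] is the single term [lambda k * gauss_seq k], of second moment at
     most [lambda k ^+ 2]. *)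
  have := partial_sum_second_moment mxi xi_cf lambda k k.+1.
  rewrite big_nat1; under eq_integral do rewrite big_nat1.
  exact.
(* On the null set where the series diverges the functional is 0; the indicator keeps its
   coordinates measurable. *)
have /choice[F FP] : forall s, exists f : dualB, forall k, eval_basis k f = \1_G s * gauss_seq k s :> R.
  move=> s; have [Gw|Gw] := pselect (G s).
    have [f fE] := functional_of_coordinates Gw.
    by exists f => k; rewrite fE indicE mem_set// mul1r.
  exists (Dual (@zero_functional_continuous R V)) => k /=.
  by rewrite indicE memNset// mul0r.
have mF : @measurable_fun _ _ (measurableTypeR R) dualB setT F.
  apply: measurable_into_dual => k; under eq_fun do rewrite FP.
  by apply: measurable_funM.
have [mu [_ muE]] := @law_ex _ _ (measurableTypeR R) dualB _ (unif R) _ mF.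
exists mu => n t c; rewrite muE; last first.
  apply: bmf_cos; apply: measurable_funD => //; apply: measurable_sum => k.
  by apply: measurable_funM => //; exact: measurable_eval_basis.
rewrite -xi_cf; apply: eq_Rintegral_ae.
- apply: bmf_cos; apply: measurable_funD => //; apply: measurable_sum => k.
  apply: measurable_funM => //; under eq_fun do rewrite FP.
  exact: measurable_funM.
- apply: bmf_cos; apply: measurable_funD => //; apply: measurable_sum => k.
  exact: measurable_funM.
- apply: ae_imply aeG => s Gs; congr (cos (_ + _)).
  by apply: eq_bigr => k _; rewrite FP indicE mem_set// mul1r.
Qed.

Lemma white_noise_of_gaussian (mu : probability dualB R) :
  (forall n (t : nat -> R) c,
    \int[mu]_s cos (\sum_(0 <= k < n) t k * eval_basis k s + c) =
    expR (- ((\sum_(0 <= k < n) t k ^+ 2) / 2)) * cos c) ->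
  white_noise e mu.
Proof.
move=> mu_cf.
have [hat [hatD hat_basis hat_cf]] := isonormal_process_exists measurable_eval_basis mu_cf eB.
exists hat; split => // [j|t x]; first by exists (test_basis j).
rewrite /complex_integral; congr Complex.
  have := hat_cf t 0 x; rewrite cos0 mulr1 => <-.
  by congr (Rintegral _ _ _); apply/funext => s; rewrite /= addr0.
(* The phase [- pi / 2] turns the cosine into a sine and makes the right side 0, as the imaginary
   part requires. *)
have := hat_cf t (- (pi / 2)) x; rewrite cosN cos_pihalf mulr0 => <-.
by congr (Rintegral _ _ _); apply/funext => s; rewrite /= cosBpihalf.
Qed.

(** By linearity [hat] sends [sum_k t_k e_k] almost everywhere to [sum_k t_k f(e_k)], so the law of
    one variable, taken at frequency 1, contains the joint law of the coordinates. *)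
Lemma white_noise_cf (nu : probability dualB R) : white_noise e nu ->
  forall n (t : nat -> R) c,
    \int[nu]_s cos (\sum_(0 <= k < n) t k * eval_basis k s + c) =
    expR (- ((\sum_(0 <= k < n) t k ^+ 2) / 2)) * cos c.
Proof.
move=> [hat [hatD hat_basis hat_cf]] n t c.
have hat_e k : {ae nu, forall s, hat (e k) s = eval_basis k s}.
  have [v ve] := hat_basis k; apply: ae_imply => s ->.
  by rewrite /eval_basis (_ : v = test_basis k)//; apply: test_eqP.
(* Linearity holds only almost everywhere, so [hat 0 = 0] has to be drawn from
   [hat 0 = hat 0 + hat 0]; it starts the induction below. *)
have hat0 : {ae nu, forall s, hat 0 s = 0}.
  have := hatD 1 0 0; rewrite scaler0 addr0; apply: ae_imply => s.
  by rewrite mul1r => /eqP; rewrite -subr_eq0 opprD addrA subrr sub0r oppr_eq0 => /eqP.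
pose x := \sum_(0 <= k < n) t k *: e k.
have hatx : {ae nu, forall s, hat x s = \sum_(0 <= k < n) t k * eval_basis k s}.
  rewrite /x; elim: n {x} => [|n IHn].
    by rewrite big_geq//; apply: ae_imply hat0 => s ->; rewrite big_geq.
  rewrite big_nat_recr//= addrC.
  apply: filterS3 IHn (hat_e n) (hatD (t n) (e n) (\sum_(0 <= k < n) t k *: e k)).
  by move=> s hS hn ->; rewrite hS hn big_nat_recr//= addrC.
have mhat : measurable_fun setT (hat x : dualB -> R) by exact: measurable_aeEqMfun.
have := hat_cf 1 x; rewrite /complex_integral expr1n mul1r => -[hcos hsin].
have nx : `|x| ^+ 2 = \sum_(0 <= k < n) t k ^+ 2 by exact: normr_sum_basis.
have cosE : \int[nu]_s cos (hat x s) = expR (- ((\sum_(0 <= k < n) t k ^+ 2) / 2)).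
  rewrite -nx -hcos.
  by congr (Rintegral _ _ _); apply/funext => s; rewrite mul1r.
have sinE : \int[nu]_s sin (hat x s) = 0.
  by rewrite -hsin; congr (Rintegral _ _ _); apply/funext => s; rewrite mul1r.
have bcos : bmf (fun s => cos (hat x s)) by exact: bmf_cos.
have bsin : bmf (fun s => sin (hat x s)).
  rewrite (_ : (fun s => _) = fun s => cos (hat x s + - (pi / 2))).
    by apply: bmf_cos; exact: measurable_funD.
  by apply/funext => s; rewrite cosBpihalf.
transitivity (\int[nu]_s (cos c * cos (hat x s) + (- sin c * sin (hat x s) + 0))).
  apply: eq_Rintegral_ae.
  - apply: bmf_cos; apply: measurable_funD => //; apply: measurable_sum => k.
    by apply: measurable_funM => //; exact: measurable_eval_basis.
  - by apply: bmfD; [exact: bmfZ|apply: bmfD; [exact: bmfZ|exact: bmf_cst]].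
  - by apply: ae_imply hatx => s <-; rewrite cosD; ring.
rewrite RintegralZD//; last by apply: bmfD; [exact: bmfZ|exact: bmf_cst].
rewrite RintegralZD//; last exact: bmf_cst.
by rewrite cosE sinE Rintegral_cst1 mulr0 !addr0 mulrC.
Qed.

Lemma white_noise_unique (mu nu : probability dualB R) :
  white_noise e mu -> white_noise e nu -> forall B, measurable B -> nu B = mu B.
Proof.
move=> wmu wnu.
pose L := [set X | exists n (t : nat -> R),
  X = fun s : dualB => \sum_(0 <= k < n) t k * eval_basis k s].
apply: (@characteristic_function_unique _ dualB R L nu mu).
- by exists (fun=> 0), 0%N, (fun=> 0); apply/funext => s; rewrite big_geq.
- move=> a _ _ [n [t ->]] [m [r ->]].
  (* Both families are padded with zeros to a common length. *)
  exists (maxn n m), (fun k => a * (if (k < n)%N then t k else 0) + if (k < m)%N then r k else 0).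
  apply/funext => s.
  have widen N (q : nat -> R) : (N <= maxn n m)%N -> \sum_(0 <= k < N) q k * eval_basis k s =
      \sum_(0 <= k < maxn n m) (if (k < N)%N then q k else 0) * eval_basis k s.
    move=> NM; rewrite (big_nat_widen _ _ _ _ _ NM) big_mkcond/=.
    by apply: eq_bigr => k _; case: ifP; rewrite ?mul0r.
  rewrite (widen _ t (leq_maxl n m)) (widen _ r (leq_maxr n m)) mulr_sumr -big_split/=.
  by apply: eq_bigr => k _; rewrite mulrDl mulrA.
- rewrite dual_borelE; apply/seteqP; split.
    apply: smallest_sub; first exact: smallest_sigma_algebra.
    move=> _ [k [a ->]]; apply: sub_sigma_algebra.
    exists (eval_basis k); last by exists a.
    exists k.+1, (fun i => (i == k)%:R); apply/funext => s.
    rewrite big_nat_recr//= eqxx mul1r big_nat big1 ?add0r// => i /andP[_ ik].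
    by rewrite ltn_eqF// mul0r.
  rewrite -dual_borelE; apply: smallest_sub; first exact: sigma_algebra_measurable.
  move=> _ [_ [n [t ->]] [a ->]].
  have mX : measurable_fun setT (fun s : dualB => \sum_(0 <= k < n) t k * eval_basis k s).
    apply: measurable_sum => k; apply: measurable_funM => //; exact: measurable_eval_basis.
  have := mX measurableT `]a, +oo[%classic (measurable_itv _).
  by rewrite setTI; congr (measurable _); apply/seteqP; split => s /=; rewrite in_itv/= andbT.
- by move=> _ c [n [t ->]]; rewrite !white_noise_cf.
Qed.

End scale.

Theorem mainTheorem3 (R : realType) (E : hilbertType R) (A : {linear E -> E})
    (e : nat -> E) (lambda : nat -> R)
    (E_separable : separable_space E)
    (E_infinite : ~ finite_dimensional E)
    (A_positive : positive_operator A)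
    (A_HS : hilbert_schmidt A)
    (e_basis : orthonormal_basis e)
    (e_eigen : forall n, A (e n) = lambda n *: e n)
    (lambda_gt0 : forall n, 0 < lambda n)
    (lambda_sum : (\sum_(0 <= n <oo) (lambda n ^+ 2)%:E < +oo)%E) :
  [/\ forall p : nat, scale_space A p =
        [set x | (\sum_(0 <= n <oo)
          (lambda n ^- (2 * p) * inner x (e n) ^+ 2)%:E < +oo)%E],
      nuclear_space (test_space A) &
      exists2 mu : probability (dual_borel (test_space A)) R,
        white_noise e mu &
        forall nu : probability (dual_borel (test_space A)) R,
          white_noise e nu ->
          forall B, measurable B -> nu B = mu B].
Proof.
have [A_sym _] := A_positive; have [A_cont _] := A_HS.
split.
- by move=> p; exact: scale_spaceE.
- exact: (test_nuclear A_sym A_cont e_basis e_eigen lambda_gt0 A_HS).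
have [mu mu_cf] := gaussian_measure_exists A_sym A_cont e_basis e_eigen lambda_gt0 lambda_sum.
have wmu : white_noise e mu by exact: white_noise_of_gaussian mu_cf.
exists mu => // nu wnu.
exact: (white_noise_unique A_sym A_cont e_basis e_eigen lambda_gt0 wmu wnu).
Qed.
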